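(* Let $G$ be a Lie group (in Milnor's sense, modeled over a Hausdorff locally convex vector space). Suppose that $G$ is constricted and admits an exponential map, and that its Lie algebra $\mathfrak g$ is sequentially complete. Then $G$ is $k$-confined for each $k\in\mathbb N\sqcup\{\mathrm{lip},\infty\}$.
   Context: Calculus: for Hausdorff locally convex vector spaces $F,E$ and $U\subseteq F$ open, a map $f:U\to E$ is differentiable at $x$ if $D_vf(x)=\lim_{t\to 0}\frac1t(f(x+tv)-f(x))$ exists in $E$ for every $v\in F$; it is $C^0$ if continuous, $C^k$ ($k\ge 1$) if all iterated directional derivatives $D_{v_p}\cdots D_{v_1}f$ ($p\le k$) exist and $(x,v_1,\dots,v_p)\mapsto D_{v_p}\cdots D_{v_1}f(x)$ is continuous on $U\times F^p$ for $0\le p\le k$; $C^\infty$ (smooth) if $C^k$ for all $k$. $G$ is a Lie group in Milnor's sense: a group that is a smooth Hausdorff manifold (in this calculus) modeled on a Hausdorff locally convex vector space $E$, with smooth multiplication and inversion. $e$ is the unit, $\mathfrak g=T_eG$ the Lie algebra with bracket $[\cdot,\cdot]$, $\mathrm{ad}\,X(Y)=[X,Y]$, $\mathrm R_g(h)=hg$, $\mathrm{Ad}_g=d_e(h\mapsto ghg^{-1})$. $\mathfrak P$ is the set of continuous seminorms on $E$. $\Xi:G\supseteq\mathcal U\to\mathcal V\subseteq E$ is a fixed chart with $e\in\mathcal U$, $\Xi(e)=0$, $\mathcal V$ convex. For $\mathfrak p\in\mathfrak P$ put $\dot{\mathfrak p}:=\mathfrak p\circ d_e\Xi$; these seminorms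 define the topology of $\mathfrak g$. $G$ is constricted if for each bounded subset $\mathrm B\subseteq\mathfrak g$ and each $\mathfrak v\in\mathfrak P$ there exist $C\ge0$ and $\mathfrak w\in\mathfrak P$ with $\mathfrak v\le\mathfrak w$ such that $\dot{\mathfrak v}\circ\mathrm{ad}\,X_1\circ\dots\circ\mathrm{ad}\,X_n\le C^n\dot{\mathfrak w}$ for all $X_1,\dots,X_n\in\mathrm B$, $n\ge1$. A curve on $[r,r']$ ($r<r'$) is $C^k$, $k\in\mathbb N\sqcup\{\infty\}$, if it is the restriction of a $C^k$-curve on an open interval containing $[r,r']$; $C^{\mathrm{lip}}([r,r'],\mathfrak g)$ is the set of curves $\phi$ such that for each $\mathfrak p\in\mathfrak P$ there is $L_{\mathfrak p}\ge0$ with $\dot{\mathfrak p}(\phi(t)-\phi(t'))\le L_{\mathfrak p}|t-t'|$ for all $t,t'$. The right logarithmic derivative of $\mu\in C^1([r,r'],G)$ is $\delta^r(\mu)(t)=d_{\mu(t)}\mathrm R_{\mu(t)^{-1}}(\dot\mu(t))$. Put $\mathfrak D_{[r,r']}:=\delta^r(C^1([r,r'],G))\subseteq C^0([r,r'],\mathfrak g)$. For $\phi=\delta^r(\mu)\in\mathfrak D_{[r,r']}$ the product integral is $\Pi_r^t\phi:=\mu(t)\mu(r)^{-1}$ (well defined). $G$ admits an exponential map if every constant curve $[0,1]\ni t\mapsto X\in\mathfrak g$ lies in $\mathfrak D_{[0,1]}$. $\mathfrak DP^0([0,1],\mathfrak g)$ is the set of maps $\phi:[0,1]\to\mathfrak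 g$ for which there exist $0=t_0<\dots<t_n=1$ and $\phi[p]\in\mathfrak D_{[t_p,t_{p+1}]}$ with $\phi|_{(t_p,t_{p+1})}=\phi[p]|_{(t_p,t_{p+1})}$ for $p=0,\dots,n-1$; then $\Pi_0^0\phi:=e$ and $\Pi_0^t\phi:=\Pi_{t_p}^t\phi[p]\cdot\Pi_{t_{p-1}}^{t_p}\phi[p-1]\cdots\Pi_{t_0}^{t_1}\phi[0]$ for $t\in(t_p,t_{p+1}]$ (well defined). Write $\dot{\mathfrak p}_\infty(\phi)=\sup_{t\in[0,1]}\dot{\mathfrak p}(\phi(t))$. A sequence $\{\phi_n\}\subseteq\mathfrak DP^0([0,1],\mathfrak g)$ is tame if for each $\mathfrak v\in\mathfrak P$ there is $\mathfrak w\in\mathfrak P$, $\mathfrak v\le\mathfrak w$, with $\dot{\mathfrak v}\circ\mathrm{Ad}_{[\Pi_0^t\phi_n]^{-1}}\le\dot{\mathfrak w}$ for all $n\in\mathbb N$, $t\in[0,1]$. It is Cauchy if for all $\mathfrak p$, $\varepsilon>0$ there is $p$ with $\dot{\mathfrak p}_\infty(\phi_m-\phi_n)\le\varepsilon$ for $m,n\ge p$; it is Mackey-Cauchy if there are $c_{\mathfrak p}\ge0$, $l_{\mathfrak p}\in\mathbb N$ ($\mathfrak p\in\mathfrak P$) and $0\le\lambda_{m,n}\to0$ (as $(m,n)\to\infty$) with $\dot{\mathfrak p}_\infty(\phi_m-\phi_n)\le c_{\mathfrak p}\lambda_{m,n}$ for all $m,n\ge l_{\mathfrak p}$, $\mathfrak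 p\in\mathfrak P$. A curve $\phi\in C^0([0,1],\mathfrak g)$ is $\mathfrak s$-integrable (resp. $\mathfrak m$-integrable) if there is a tame Cauchy (resp. tame Mackey-Cauchy) sequence in $\mathfrak DP^0([0,1],\mathfrak g)$ converging to $\phi$ uniformly (i.e. in all $\dot{\mathfrak p}_\infty$). $G$ is $0$-confined if each $\phi\in C^0([0,1],\mathfrak g)$ is $\mathfrak s$-integrable; for $k\in\mathbb N_{\ge1}\sqcup\{\mathrm{lip},\infty\}$, $G$ is $k$-confined if each $\phi\in C^k([0,1],\mathfrak g)$ is $\mathfrak m$-integrable. *)

(* Defs.v *)
From HB Require Import structures.
From mathcomp Require Import all_boot all_order all_algebra.
From mathcomp Require Import all_classical all_reals all_analysis.

Set Implicit Arguments.
Unset Strict Implicit.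
Unset Printing Implicit Defensive.

Import Order.TTheory GRing.Theory Num.Theory.
Import numFieldNormedType.Exports.

Local Open Scope classical_set_scope.
Local Open Scope ring_scope.

(** * Calculus on locally convex spaces

    [derive] and [derivable] of MathComp-Analysis require normed spaces; the
    versions below are the same formulas for topological vector spaces. *)

Section Calculus.
Context {R : realType} {F E : tvsType R}.
Implicit Types (U : set F) (f : F -> E).

Definition dquot f (x v : F) (t : R) : E := t^-1 *: (f (x + t *: v) - f x).

Definition ddiff f (x v : F) : Prop :=
  exists l : E, dquot f x v @ 0^' --> l.

Definition dder f (x v : F) : E :=
  xget 0 [set l : E | dquot f x v @ 0^' --> l].

(** [iter_dder f [:: v_1; ..; v_p]] is [D_{v_p} .. D_{v_1} f]. *)
Fixpoint iter_dder f (s : seq F) : F -> E :=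
  if s is v :: s' then iter_dder (fun x => dder f x v) s' else f.

(** [U] is meant to be open, so that the values of [f] outside [U] are
    irrelevant. *)
Definition Cn (k : nat) U f : Prop :=
  (forall (s : seq F) (v x : F), (size s < k)%N -> U x -> ddiff (iter_dder f s) x v)
  /\ (forall p : nat, (p <= k)%N ->
        {within U `*` setT, continuous
          (fun z : F * {ptws 'I_p -> F} => iter_dder f [seq z.2 i | i : 'I_p] z.1)}).

Definition Csmooth U f : Prop := forall k, Cn k U f.

End Calculus.

Section Seminorms.
Context {R : realType} {E : tvsType R}.

Definition cseminorm : set (E -> R) :=
  [set p | [/\ forall x y, p (x + y) <= p x + p y,
               forall (a : R) x, p (a *: x) = `|a| * p x &
               continuous p]].

Definition seq_complete : Prop :=
  forall u : nat -> E,
    (forall W : set E, nbhs 0 W ->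
       exists N, forall m n, (N <= m)%N -> (N <= n)%N -> W (u m - u n)) ->
    exists l : E, u @ \oo --> l.

End Seminorms.
Arguments seq_complete {R} E.

(** * Lie groups modeled on locally convex spaces *)

(** The maps of a chart are total; only their restrictions to [cdom] and [cimg]
    are meaningful. *)
Record chart (R : realType) (E : tvsType R) (G : topologicalType) := Chart {
  cdom : set G;
  cimg : set E;
  cfun :> G -> E;
  cinv : E -> G;
  cdom_open : open cdom;
  cimg_open : open cimg;
  cfun_img : forall g, cdom g -> cimg (cfun g);
  cinv_dom : forall x, cimg x -> cdom (cinv x);
  cfunK : forall g, cdom g -> cinv (cfun g) = g;
  cinvK : forall x, cimg x -> cfun (cinv x) = x;
  cfun_continuous : {within cdom, continuous cfun};
  cinv_continuous : {within cimg, continuous cinv} }.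

Section Charts.
Context {R : realType} {E : tvsType R} {G : topologicalType}.

Definition smooth_transition (c c' : chart E G) : Prop :=
  Csmooth (cimg c `&` cinv c @^-1` cdom c') (c' \o cinv c).

(** [C^k]-maps from a subset [U], open, of a locally convex space to the
    manifold with atlas [A]. *)
Definition CnMap {F : tvsType R} (A : set (chart E G)) (k : nat)
    (U : set F) (f : F -> G) : Prop :=
  {within U, continuous f} /\
  forall c, A c -> Cn k (U `&` f @^-1` cdom c) (c \o f).

Definition CsmoothMap {F : tvsType R} (A : set (chart E G))
    (U : set F) (f : F -> G) : Prop :=
  forall k, CnMap A k U f.

End Charts.

HB.structure Definition GroupTopological := {G of Group G & Topological G}.

HB.mixin Record isMilnorLieGroup (R : realType) (E : tvsType R) G
    of GroupTopological G := {
  atlas : set (chart E G);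
  lie_hausdorff : hausdorff_space G;
  atlas_cover : forall g : G, exists2 c, atlas c & cdom c g;
  atlas_compatible : forall c c', atlas c -> atlas c' -> smooth_transition c c';
  mul_smooth : forall c c', atlas c -> atlas c' ->
    CsmoothMap atlas (cimg c `*` cimg c')
      (fun z : E * E => (cinv c z.1 * cinv c' z.2)%g);
  inv_smooth : forall c, atlas c ->
    CsmoothMap atlas (cimg c) (fun x : E => (cinv c x)^-1%g) }.

#[short(type="milnorLieGroupType")]
HB.structure Definition MilnorLieGroup (R : realType) (E : tvsType R) :=
  {G of GroupTopological G & isMilnorLieGroup R E G}.

Section Tangent.
Context {R : realType} {E : tvsType R} {G : milnorLieGroupType E}.

Definition chart_at (g : G) : chart E G := s2val (cid2 (atlas_cover g)).

(** [T_g G], each tangent vector being represented by its coordinates in the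
    chart [chart_at g]. *)
Definition tangent (g : G) : tvsType R := E.

Definition tmap (f : G -> G) (g : G) (v : tangent g) : tangent (f g) :=
  dder (chart_at (f g) \o f \o cinv (chart_at g)) (chart_at g g) v.

Definition dchart (c : chart E G) (g : G) (v : tangent g) : E :=
  dder (c \o cinv (chart_at g)) (chart_at g g) v.

Definition velocity (mu : R -> G) (t : R) : tangent (mu t) :=
  dder (chart_at (mu t) \o mu : R^o -> E) t 1.

End Tangent.
Arguments tangent {R E G} g.
Arguments dchart {R E G} c g v.

Definition liealg {R : realType} {E : tvsType R} (G : milnorLieGroupType E) :
  tvsType R := tangent (1%g : G).

Section LieAlgebra.
Context {R : realType} {E : tvsType R} {G : milnorLieGroupType E}.
Implicit Types (X Y : liealg G) (g : G).

(** Below, [T_{g * 1} G] and [T_g G], etc., are the same space in the same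
    coordinates since the charts [chart_at (g * 1)] and [chart_at g] are equal. *)

Definition left_invariant X (g : G) : tangent g :=
  tmap (fun h => g * h)%g (X : tangent 1%g).

(** Coordinates of the left invariant vector field generated by [X] in the
    chart that serves to represent [T_e G]. *)
Definition left_invariant_coord X (x : E) : E :=
  let c := chart_at (1%g : G) in dchart c (cinv c x) (left_invariant X (cinv c x)).

(** Value at the unit of the commutator of the left invariant vector fields. *)
Definition bracket X Y : liealg G :=
  let x0 := chart_at (1%g : G) 1%g in
  let vX := left_invariant_coord X in
  let vY := left_invariant_coord Y in
  dder vY x0 (vX x0) - dder vX x0 (vY x0).

Definition ad X : liealg G -> liealg G := bracket X.

Definition Ad (g : G) : liealg G -> liealg G :=
  fun X => tmap (fun h => g * h * g^-1)%g (X : tangent 1%g).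

Definition rlogder (mu : R -> G) (t : R) : liealg G :=
  tmap (fun h => h * (mu t)^-1)%g (velocity mu t).

(** [phi] is the right logarithmic derivative on [[r, r']] of a curve in
    [C^1([r, r'], G)]; [mu] is an extension of this curve to an open interval. *)
Definition rprimitive (r r' : R) (phi : R -> liealg G) (mu : R -> G) : Prop :=
  (exists a b : R, [/\ a < r, r' < b &
     CnMap (atlas : set (chart E G)) 1 ([set` `]a, b[] : set R^o) mu]) /\
  {in `[r, r'], forall t, phi t = rlogder mu t}.

Definition Dset (r r' : R) : set (R -> liealg G) :=
  [set phi | exists mu, rprimitive r r' phi mu].

(** [Pi_r^t phi], for [phi] in [Dset r r'] and [t] in [[r, r']]; it does not
    depend on the primitive chosen. *)
Definition prodint (r r' : R) (phi : R -> liealg G) (t : R) : G :=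
  let mu := xget (fun=> 1%g) [set mu | rprimitive r r' phi mu] in
  (mu t * (mu r)^-1)%g.

Definition has_exp : Prop := forall X : liealg G, Dset 0 1 (fun=> X).

Definition DP0_decomp (n : nat) (s : nat -> R) (psi : nat -> R -> liealg G)
    (phi : R -> liealg G) : Prop :=
  [/\ s 0%N = 0, s n = 1,
      forall p, (p < n)%N -> s p < s p.+1 &
      forall p, (p < n)%N ->
        Dset (s p) (s p.+1) (psi p) /\
        {in `]s p, s p.+1[, forall t, phi t = psi p t}].

Definition DP0 : set (R -> liealg G) :=
  [set phi | exists n s psi, DP0_decomp n s psi phi].

Fixpoint prodint_upto (s : nat -> R) (psi : nat -> R -> liealg G) (p : nat) : G :=
  if p is q.+1 then
    (prodint (s q) (s q.+1) (psi q) (s q.+1) * prodint_upto s psi q)%g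
  else 1%g.

Definition DP0_prodint_at (phi : R -> liealg G) (t : R) (g : G) : Prop :=
  (t = 0 /\ g = 1%g) \/
  exists n s psi p, [/\ DP0_decomp n s psi phi, (p < n)%N, s p < t <= s p.+1 &
    g = (prodint (s p) (s p.+1) (psi p) t * prodint_upto s psi p)%g].

(** [Pi_0^t phi], for [phi] in [DP0] and [t] in [[0, 1]]; it does not depend on
    the decomposition chosen. *)
Definition DP0_prodint (phi : R -> liealg G) (t : R) : G :=
  xget 1%g [set g | DP0_prodint_at phi t g].

End LieAlgebra.
Arguments has_exp {R E} G.

(** * Constricted and confined Lie groups *)

Definition smooth_chart {R : realType} {E : tvsType R} {G : milnorLieGroupType E}
    (Xi : chart E G) : Prop :=
  forall c, atlas c -> smooth_transition c Xi /\ smooth_transition Xi c.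

(** The index [k] of "[k]-confined". *)
Inductive regularity := RegFin of nat | RegLip | RegInfty.

Section Confined.
Context {R : realType} {E : tvsType R} {G : milnorLieGroupType E}.
Variable Xi : chart E G.
Implicit Types (p v w : E -> R) (phi : R -> liealg G).

Definition dotp p (X : liealg G) : R := p (dchart Xi 1%g X).

Definition bounded_in_liealg (B : set (liealg G)) : Prop :=
  forall p, cseminorm p -> exists M : R, forall X, B X -> dotp p X <= M.

(** [ad_iter [:: X_1; ..; X_n]] is [ad X_1 \o .. \o ad X_n]. *)
Definition ad_iter (s : seq (liealg G)) (Y : liealg G) : liealg G :=
  foldr (fun X Z => ad X Z) Y s.

Definition constricted : Prop :=
  forall (B : set (liealg G)) v, bounded_in_liealg B -> cseminorm v ->
  exists (C : R) w, [/\ 0 <= C, cseminorm w, forall x, v x <= w x &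
    forall s : seq (liealg G), (0 < size s)%N -> (forall X, X \in s -> B X) ->
    forall Y, dotp v (ad_iter s Y) <= C ^+ size s * dotp w Y].

Definition psup p phi : \bar R :=
  ereal_sup [set (dotp p (phi t))%:E | t in `[0, 1]].

Definition tame (phi_ : nat -> R -> liealg G) : Prop :=
  forall v, cseminorm v ->
  exists w, [/\ cseminorm w, forall x, v x <= w x &
    forall n (t : R) X, t \in `[0, 1] ->
      dotp v (Ad (DP0_prodint (phi_ n) t)^-1%g X) <= dotp w X].

Definition unif_Cauchy (phi_ : nat -> R -> liealg G) : Prop :=
  forall p (e : R), cseminorm p -> 0 < e ->
  exists l, forall m n, (l <= m)%N -> (l <= n)%N ->
    (psup p (phi_ m \- phi_ n)%R <= e%:E)%E.

Definition Mackey_Cauchy (phi_ : nat -> R -> liealg G) : Prop :=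
  exists lambda : nat -> nat -> R,
  [/\ forall m n, 0 <= lambda m n,
      lambda x.1 x.2 @[x --> (\oo, \oo)] --> (0 : R) &
      forall p, cseminorm p -> exists (c : R) (l : nat), 0 <= c /\
        forall m n, (l <= m)%N -> (l <= n)%N ->
          (psup p (phi_ m \- phi_ n)%R <= (c * lambda m n)%:E)%E].

Definition unif_converges (phi_ : nat -> R -> liealg G) phi : Prop :=
  forall p (e : R), cseminorm p -> 0 < e ->
  exists l, forall n, (l <= n)%N -> (psup p (phi \- phi_ n)%R <= e%:E)%E.

Definition s_integrable phi : Prop :=
  exists phi_ : nat -> R -> liealg G,
  [/\ forall n, DP0 (phi_ n), tame phi_, unif_Cauchy phi_ &
      unif_converges phi_ phi].

Definition m_integrable phi : Prop :=
  exists phi_ : nat -> R -> liealg G,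
  [/\ forall n, DP0 (phi_ n), tame phi_, Mackey_Cauchy phi_ &
      unif_converges phi_ phi].

(** Restriction to [[0, 1]] of a curve of class [C] on an open interval. *)
Definition restricted_curve (C : set R^o -> (R^o -> liealg G) -> Prop) phi : Prop :=
  exists (a b : R) (psi : R -> liealg G),
  [/\ a < 0, 1 < b, C [set` `]a, b[] psi & {in `[0, 1], forall t, phi t = psi t}].

Definition lip_curve phi : Prop :=
  forall p, cseminorm p -> exists2 L : R, 0 <= L &
    {in `[0, 1] &, forall t t', dotp p (phi t - phi t') <= L * `|t - t'|}.

Definition confined (k : regularity) : Prop :=
  match k with
  | RegFin 0 => forall phi, restricted_curve (Cn 0) phi -> s_integrable phi
  | RegFin n => forall phi, restricted_curve (Cn n) phi -> m_integrable phi
  | RegLip => forall phi, lip_curve phi -> m_integrable phi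
  | RegInfty => forall phi, restricted_curve Csmooth phi -> m_integrable phi
  end.

End Confined.

(* Main.v *)
Require Import Defs.
From mathcomp Require Import all_boot all_order all_algebra.
From mathcomp Require Import all_classical all_reals all_analysis.
From mathcomp Require Import ring lra.

Set Implicit Arguments.
Unset Strict Implicit.
Unset Printing Implicit Defensive.

Import Order.TTheory GRing.Theory Num.Theory.
Import numFieldNormedType.Exports.

Local Open Scope classical_set_scope.
Local Open Scope ring_scope.

(** The idea is to approximate a curve [phi] by the step functions that are
    constant, equal to [phi (k / n)], on the intervals from [k / n] to [(k + 1) / n].
    As [G] has an exponential map, constant curves have primitives, so step functions
    belong to [DP0]. They converge uniformly to [phi] because [phi] is uniformly
    continuous, and if [phi] is Lipschitz (which [C^1]-curves are on a compact
    interval, by the mean value estimate) the distance between the [m]-th and the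
    [n]-th one is at most a constant times [1 / m + 1 / n], which is the Mackey
    condition. All the work is in tameness.

    Let [B] be the set of values of [phi], a bounded set. Constrictedness gives,
    for each [v], constants [K] and [w] with [v (ad X_1 .. ad X_n Z) <= K^n w (Z)]
    for [X_i] in [B]. Then
      [N Z = sup (K^-n v (ad X_1 .. ad X_n Z))],
    over all finite words in [B], is a continuous seminorm with [v <= N <= w], and
    now [N (ad X Z) <= K (N Z)] for [X] in [B] ([ad_seminorm_bracket]): in this
    seminorm each [ad X] is bounded by [K].

    If [mu] is a [C^1]-curve in [G] and [t] is fixed, [eta s = Ad (mu s * (mu t)^-1) Y]
    solves the linear equation [eta' = ad (rlogder mu s) eta], with [eta t = Y]
    ([Ad_curve_der]). When the logarithmic derivative takes its values in [B],
    Gronwall's inequality run backwards from [t] to [r] bounds the value at [r],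
    which is the inverse of the adjoint action of the product integral from [r] to
    [t]: [N (Ad (..)^-1 Y) <= exp (K (t - r)) (N Y)] ([Ad_prodint_le]). These
    bounds multiply along the pieces of a curve in [DP0], whichever decomposition
    and whichever primitives are used, so that [exp K * w] dominates
    [v \o Ad (..)^-1] uniformly in the step function and in [t].

    The equation for [eta] reduces by the group law to the statement that the
    derivative at [1] of [g |-> Ad g Z] is the bracket ([Ad_curve_der_at1]). This
    is a computation with the multiplication [m (x, y)] read in the chart at [1]:
    [Ad g] is the derivative of left multiplication by [g] followed by right
    multiplication by [g^-1], and the symmetry of second derivatives of [m] turns
    the result into the commutator of left invariant vector fields.

    The calculus behind it is obtained from two facts: continuous seminorms, the
    gauges of convex symmetric neighborhoods, describe the topology of a locally
    convex space ([cseminorm_nbhs]), and a curve whose derivative stays within [M]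
    of [v] for such a seminorm satisfies the corresponding mean value estimate
    ([mean_value_le]). They imply that [C^1]-maps are strictly differentiable
    ([C1_strict_der]), from which linearity of the derivative, the chain rule and
    the symmetry of second derivatives follow. *)

(** * Continuous seminorms *)

Section TvsLimits.
Context {R : realType} {E : tvsType R}.

Lemma tvs_cvgD (T : Type) (F : set_system T) {FF : Filter F} (f g : T -> E) a b :
  f @ F --> a -> g @ F --> b -> (fun x => f x + g x) @ F --> a + b.
Proof.
move=> fa gb; apply: (@continuous2_cvg _ E E E F FF f g +%R) => //.
exact: (@add_continuous E (a, b)).
Qed.

Lemma tvs_cvgZ (T : Type) (F : set_system T) {FF : Filter F} (r : T -> R)
    (f : T -> E) (a : R) b :
  r @ F --> a -> f @ F --> b -> (fun x => r x *: f x) @ F --> a *: b.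
Proof.
move=> fa gb; apply: (@continuous2_cvg _ R E E F FF r f *:%R) => //.
exact: (@scale_continuous R E (a, b)).
Qed.

Lemma tvs_cvgN (T : Type) (F : set_system T) {FF : Filter F} (f : T -> E) a :
  f @ F --> a -> (fun x => - f x) @ F --> - a.
Proof.
move=> fa; under eq_fun do rewrite -scaleN1r.
by rewrite -scaleN1r; apply: tvs_cvgZ => //; exact: cvg_cst.
Qed.

Lemma tvs_cvgB (T : Type) (F : set_system T) {FF : Filter F} (f g : T -> E) a b :
  f @ F --> a -> g @ F --> b -> (fun x => f x - g x) @ F --> a - b.
Proof. by move=> fa gb; apply: tvs_cvgD => //; exact: tvs_cvgN. Qed.

End TvsLimits.

Section SeminormTheory.
Context {R : realType} {E : tvsType R} (p : E -> R).
Hypothesis ps : cseminorm p.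

Lemma cseminormD x y : p (x + y) <= p x + p y. Proof. by case: ps. Qed.

Lemma cseminormZ a x : p (a *: x) = `|a| * p x. Proof. by case: ps. Qed.

Lemma cseminorm0 : p 0 = 0.
Proof. by rewrite -(scale0r 0) cseminormZ normr0 mul0r. Qed.

Lemma cseminormN x : p (- x) = p x.
Proof. by rewrite -scaleN1r cseminormZ normrN1 mul1r. Qed.

Lemma cseminorm_ge0 x : 0 <= p x.
Proof. by have := cseminormD x (- x); rewrite subrr cseminorm0 cseminormN; lra. Qed.

Lemma cseminormB x y : p (x - y) <= p x + p y.
Proof. by have := cseminormD x (- y); rewrite cseminormN. Qed.

Lemma cseminorm_cvg (T : Type) (F : set_system T) {FF : Filter F} (f : T -> E) l :
  f @ F --> l -> (fun x => p (f x)) @ F --> p l.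
Proof. by move=> fl; case: ps => _ _ pc; exact: cvg_comp fl (pc l). Qed.

Lemma cseminorm_cvg_near (T : Type) (F : set_system T) {FF : Filter F} (f : T -> E) l :
  f @ F --> l -> forall e, 0 < e -> \forall x \near F, p (f x - l) < e.
Proof.
move=> fl e e0.
have : (fun x => p (f x - l)) @ F --> p (l - l).
  by apply: cseminorm_cvg; apply: tvs_cvgB => //; exact: cvg_cst.
rewrite subrr cseminorm0 => /cvgr_dist_lt /(_ _ e0); apply: filterS => x.
by rewrite sub0r normrN ger0_norm// cseminorm_ge0.
Qed.

End SeminormTheory.

Section Gauge.
Context {R : realType} {E : tvsType R}.

Lemma convex_setE (A : set E) : convex_set A -> forall x y (t : R),
  0 <= t -> t <= 1 -> A x -> A y -> A (t *: x + (1 - t) *: y).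
Proof.
move=> cA x y t t0 t1 /mem_set Ax /mem_set Ay.
by have /set_mem := cA x y (Itv01 t0 t1) Ax Ay.
Qed.

(** The Minkowski functional of [V]: [x] is at gauge less than [t] when it lies
    in a smaller multiple of [V]. *)
Definition gauge (V : set E) (x : E) : R := inf [set t | 0 < t /\ V (t^-1 *: x)].

Variable V : set E.
Hypothesis V0 : nbhs 0 V.
Hypothesis Vsym : forall x, V x -> V (- x).
Hypothesis Vconv : forall x y (t : R), 0 <= t -> t <= 1 -> V x -> V y ->
  V (t *: x + (1 - t) *: y).

(** Scaling is continuous at [0], so [V] absorbs [x]; this is what makes the
    infimum defining the gauge one over a nonempty set. *)
Lemma absorbing x : exists2 t : R, 0 < t & V (t^-1 *: x).
Proof.
have : (fun s : R => s *: x) @ 0^'+ --> (0 : R) *: x.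
  apply: tvs_cvgZ; last exact: cvg_cst.
  exact: cvg_at_right_filter.
rewrite scale0r => /(_ _ V0) h.
near (0:R)^'+ => s.
have s0 : 0 < s by near: s; exact: nbhs_right_gt.
exists s^-1; first by rewrite invr_gt0.
by rewrite invrK; near: s.
Unshelve. all: by end_near. Qed.

Let S x := [set t | 0 < t /\ V (t^-1 *: x)].

Lemma gauge_has_inf x : has_inf (S x).
Proof.
split; first by have [t t0 Vt] := absorbing x; exists t.
by exists 0 => t [/ltW].
Qed.

Lemma gauge_le x t : 0 < t -> V (t^-1 *: x) -> gauge V x <= t.
Proof. by move=> t0 Vt; apply: ge_inf => //; case: (gauge_has_inf x). Qed.

Lemma gauge_lt x t : gauge V x < t -> exists s, [/\ 0 < s, s < t & V (s^-1 *: x)].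
Proof.
move=> xt; have e0 : 0 < t - gauge V x by rewrite subr_gt0.
have [s [s0 Vs] st] := inf_adherent e0 (gauge_has_inf x).
by exists s; split => //; move: st; rewrite /gauge addrC subrK.
Qed.

Lemma gauge_ge0 x : 0 <= gauge V x.
Proof. by apply: lb_le_inf; [case: (gauge_has_inf x)|move=> t [/ltW]]. Qed.

Lemma gauge_lt1 x : gauge V x < 1 -> V x.
Proof.
case/gauge_lt => s [s0 s1 Vs].
have := @Vconv _ _ s (ltW s0) (ltW s1) Vs (nbhs_singleton V0).
by rewrite scaler0 addr0 scalerA divff ?gt_eqF// scale1r.
Qed.

Lemma gaugeD x y : gauge V (x + y) <= gauge V x + gauge V y.
Proof.
apply/ler_addgt0Pr => e e0.
have e20 : 0 < e / 2 by rewrite divr_gt0.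
have /gauge_lt[s [s0 sx Vs]] : gauge V x < gauge V x + e / 2 by rewrite ltrDl.
have /gauge_lt[t [t0 ty Vt]] : gauge V y < gauge V y + e / 2 by rewrite ltrDl.
have st0 : 0 < s + t by rewrite addr_gt0.
apply: (@le_trans _ _ (s + t)); last by lra.
apply: gauge_le => //.
have d1 : s / (s + t) <= 1 by rewrite ler_pdivrMr// mul1r lerDl ltW.
have d0 : 0 <= s / (s + t) by rewrite divr_ge0// ltW.
have := @Vconv _ _ (s / (s + t)) d0 d1 Vs Vt.
rewrite !scalerA scalerDr; congr (V (_ *: _ + _ *: _)).
  by field; rewrite ?gt_eqF.
by field; rewrite ?gt_eqF.
Qed.

Lemma gaugeZ_le a x : a != 0 -> gauge V (a *: x) <= `|a| * gauge V x.
Proof.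
move=> a0; have a0' : 0 < `|a| by rewrite normr_gt0.
apply/ler_addgt0Pr => e e0.
have ea : 0 < e / `|a| by rewrite divr_gt0.
have /gauge_lt[s [s0 sx Vs]] : gauge V x < gauge V x + e / `|a| by rewrite ltrDl.
have st : `|a| * s <= `|a| * gauge V x + e.
  have : `|a| * s <= `|a| * (gauge V x + e / `|a|) by rewrite ler_pM2l// ltW.
  by rewrite mulrDr [`|a| * (e / _)]mulrC divfK// gt_eqF.
apply: le_trans st; apply: gauge_le; first by rewrite mulr_gt0.
rewrite scalerA invfM [_ * s^-1]mulrC -mulrA -scalerA.
have [ap|an|/eqP] := ltrgtP a 0; last by rewrite (negbTE a0).
  rewrite ltr0_norm// invrN mulNr mulVf// scaleN1r scalerN; exact: Vsym.
by rewrite gtr0_norm// mulVf// scale1r.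
Qed.

Lemma gaugeZ a x : gauge V (a *: x) = `|a| * gauge V x.
Proof.
have [->|a0] := eqVneq a 0.
  rewrite scale0r normr0 mul0r; apply/eqP; rewrite eq_le gauge_ge0 andbT.
  apply/ler_addgt0Pr => e e0; rewrite add0r; apply: gauge_le => //.
  by rewrite scaler0; exact: nbhs_singleton.
apply/eqP; rewrite eq_le gaugeZ_le//=.
have := @gaugeZ_le a^-1 (a *: x).
rewrite scalerA mulVf// scale1r invr_eq0 => /(_ a0).
by rewrite normfV mulrC ler_pdivlMr ?normr_gt0// mulrC.
Qed.

Lemma gauge_continuous : continuous (gauge V).
Proof.
move=> x; apply/cvgrPdist_lt => e e0.
have e20 : 0 < e / 2 by rewrite divr_gt0.
have h : \forall y \near x, V ((e / 2)^-1 *: (x - y)).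
  have : (fun y => (e / 2)^-1 *: (x - y)) @ x --> (e / 2)^-1 *: (x - x).
    by apply: tvs_cvgZ; [exact: cvg_cst|apply: tvs_cvgB; [exact: cvg_cst|exact: cvg_id]].
  by rewrite subrr scaler0 => /(_ _ V0).
apply: filterS h => y Vy.
have xy : gauge V (x - y) <= e / 2 by exact: gauge_le.
have yx : gauge V (y - x) <= e / 2.
  by apply: gauge_le => //; rewrite -opprB scalerN; exact: Vsym.
have := gaugeD (x - y) y; have := gaugeD (y - x) x.
rewrite !subrK ltr_norml => *; apply/andP; split; lra.
Qed.

Lemma gauge_cseminorm : cseminorm (gauge V).
Proof. by split; [exact: gaugeD|exact: gaugeZ|exact: gauge_continuous]. Qed.

End Gauge.

Section SeminormTopology.
Context {R : realType} {E : tvsType R}.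

(** A convex neighborhood intersected with its opposite is convex and symmetric,
    and the gauge of such a set is a seminorm whose open unit ball lies in it. *)
Lemma cseminorm_nbhs (W : set E) : nbhs 0 W ->
  exists2 p, cseminorm p & forall x, p x < 1 -> W x.
Proof.
move=> W0.
have [B Bconv [Bo /(_ 0 W W0) [A [BA A0] AW]]] := @locally_convex R E.
have Ao : nbhs 0 A by apply: open_nbhs_nbhs; split => //; exact: Bo.
have cA := convex_setE (Bconv A (mem_set BA)).
pose V := A `&` [set x | A (- x)].
have V0 : nbhs 0 V.
  apply: filterI => //.
  have : (fun x : E => - x) @ 0 --> - (0 : E) by apply: tvs_cvgN; exact: cvg_id.
  by rewrite oppr0 => /(_ _ Ao).
have Vs x : V x -> V (- x) by case=> Ax Anx; split => //=; rewrite opprK.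
have Vc x y (t : R) : 0 <= t -> t <= 1 -> V x -> V y -> V (t *: x + (1 - t) *: y).
  move=> t0 t1 [Ax Anx] [Ay Any]; split; first exact: cA.
  by rewrite /= opprD -!scalerN; exact: cA.
exists (gauge V); first exact: gauge_cseminorm.
by move=> x /(gauge_lt1 V0 Vc)[Ax _]; exact: AW.
Qed.

(** Reduces convergence in a locally convex space to real estimates, to which the
    mean value estimate applies. *)
Lemma cvg_cseminorm (T : Type) (F : set_system T) {FF : Filter F} (f : T -> E) l :
  (forall p, cseminorm p -> forall e : R, 0 < e -> \forall x \near F, p (f x - l) < e) ->
  f @ F --> l.
Proof.
move=> h W Wl.
have : nbhs 0 [set x | W (x + l)].
  have : (fun x : E => x + l) @ 0 --> 0 + l.
    by apply: tvs_cvgD; [exact: cvg_id|exact: cvg_cst].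
  by rewrite add0r => /(_ _ Wl).
case/cseminorm_nbhs => p ps pW; apply: filterS (h p ps 1 ltr01) => x /pW /=.
by rewrite subrK.
Qed.

End SeminormTopology.

(** * Mean value estimates *)

Section Growth.
Context {R : realType}.
Implicit Types (f : R -> R) (a b : R).

(** A one-sided bound on increments suffices, so that it applies to
    [p \o g] for a seminorm [p] and a differentiable curve [g], which is in
    general not differentiable. If [f b > f a], tilting [f] by a small slope and
    looking at the last point that does not exceed the starting value gives a
    contradiction, as the function cannot grow faster than that slope there. *)
Lemma dini_nonincreasing f a b : a <= b ->
  {within `[a, b], continuous f} ->
  (forall s, s \in `]a, b[ -> forall e, 0 < e ->
     \forall h \near (0:R)^'+, f (s + h) <= f s + h * e) ->
  f b <= f a.
Proof.
rewrite le_eqVlt => /predU1P[->//|ab] fc fd.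
rewrite leNgt; apply/negP => fab.
pose e := (f b - f a) / (2 * (b - a)).
have ba0 : 0 < b - a by lra.
have e0 : 0 < e by rewrite divr_gt0//; lra.
pose g s := f s - e * s.
have gab : g a < g b.
  rewrite /g -subr_gt0.
  suff -> : f b - e * b - (f a - e * a) = (f b - f a) / 2 by rewrite divr_gt0//; lra.
  by rewrite /e; field; rewrite gt_eqF.
have [fio fa fb] := (continuous_within_itvP f ab).1 fc.
have ga : g x @[x --> a^'+] --> g a.
  apply: cvgB => //; apply: cvgM; first exact: cvg_cst.
  exact: cvg_at_right_filter.
have gb : g x @[x --> b^'-] --> g b.
  apply: cvgB => //; apply: cvgM; first exact: cvg_cst.
  exact: cvg_at_left_filter.
have gc x : x \in `]a, b[ -> g y @[y --> x] --> g x.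
  by move=> xab; apply: cvgB; [exact: fio|apply: cvgM; [exact: cvg_cst|exact: cvg_id]].
(* the growth condition is available in the open interval only, so the
   argument starts at some [a' > a] *)
have [a' [a'a a'b ga']] : exists a', [/\ a < a', a' < b & g a' < g b].
  near a^'+ => a'.
  exists a'; split.
  - by near: a'; exact: nbhs_right_gt.
  - by near: a'; exact: nbhs_right_lt.
  - by near: a'; apply: (cvgr_lt _ ga).
(* the last point at which [g] has not yet exceeded its value at [a'] *)
pose S := [set s | a' <= s <= b /\ g s <= g a'].
have Sa' : S a' by split => //; rewrite lexx ltW.
have Sub : ubound S b by move=> s [/andP[]].
have Ssup : has_sup S by split; [exists a'|exists b].
pose c := sup S.
have a'c : a' <= c by apply: ub_le_sup => //; exists b.
have cb : c <= b by apply: ge_sup => //; exists a'.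
have gle : g c <= g a'.
  rewrite leNgt; apply/negP => gca.
  have : \forall x \near c^'-, g a' < g x.
    apply: (cvgr_gt (g c)) => //.
    have [->//|cb'] := eqVneq c b.
    apply: cvg_at_left_filter; apply: gc.
    by rewrite in_itv/= (lt_le_trans a'a a'c) lt_neqAle cb' cb.
  move=> /nbhs_ballP[d /= d0 dP].
  have [s Ss sd] := sup_adherent d0 Ssup.
  have sc : s <= c by apply: ub_le_sup => //; exists b.
  move: Ss sc => [sab gs]; rewrite le_eqVlt => /predU1P[sc|sc].
    by move: gs; rewrite sc leNgt gca.
  suff : g a' < g s by rewrite ltNge gs.
  apply: dP => //=; rewrite /ball/= ger0_norm; rewrite -/c in sd; lra.
have cb' : c < b.
  by rewrite lt_neqAle cb andbT; apply/eqP => cb'; rewrite cb' leNgt ga' in gle.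
have cab : c \in `]a, b[ by rewrite in_itv/= (lt_le_trans a'a a'c).
have [h [h0 hb hf]] : exists h, [/\ 0 < h, h < b - c & f (c + h) <= f c + h * e].
  near (0:R)^'+ => h; exists h; split.
  - by near: h; exact: nbhs_right_gt.
  - by near: h; apply: nbhs_right_lt; rewrite subr_gt0.
  - by near: h; exact: fd.
have : c + h <= c.
  apply: ub_le_sup; first by exists b.
  split; first by apply/andP; split; lra.
  by apply: le_trans gle; rewrite /g; lra.
lra.
Unshelve. all: by end_near. Qed.

End Growth.

(** * Differentiable curves *)

Section Curves.
Context {R : realType} {E : tvsType R}.
Implicit Types (g : R -> E) (p : E -> R).

Definition curve_der g (t : R) (d : E) : Prop := dquot (g : R^o -> E) t 1 @ 0^' --> d.

Lemma curve_dquotE g t h : dquot (g : R^o -> E) t 1 h = h^-1 *: (g (t + h) - g t).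
Proof. by rewrite /dquot (_ : h *: (1 : R^o) = h)//; exact: mulr1. Qed.

Lemma dquotK (F : tvsType R) (f : F -> E) x v t : t != 0 ->
  f (x + t *: v) = f x + t *: dquot f x v t.
Proof. by move=> t0; rewrite /dquot scalerA divff// scale1r [RHS]addrC subrK. Qed.

Lemma curve_dquotK g t h : g (t + h) = g t + h *: dquot (g : R^o -> E) t 1 h.
Proof.
have [->|h0] := eqVneq h 0; first by rewrite scale0r !addr0.
by rewrite curve_dquotE scalerA divff// scale1r [RHS]addrC subrK.
Qed.

Lemma curve_derB g1 g2 t d1 d2 : curve_der g1 t d1 -> curve_der g2 t d2 ->
  curve_der (fun s => g1 s - g2 s) t (d1 - d2).
Proof.
move=> h1 h2; rewrite /curve_der.
suff -> : dquot (fun s => g1 s - g2 s : E) (t : R^o) 1 =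
    (fun h => dquot (g1 : R^o -> E) t 1 h - dquot (g2 : R^o -> E) t 1 h).
  exact: tvs_cvgB.
apply/funext => h; rewrite !curve_dquotE -scalerBr; congr (_ *: _).
by rewrite !opprB addrACA [RHS]addrACA [- g1 t + _]addrC.
Qed.

Lemma curve_der_cvg0 g t d : curve_der g t d -> g (t + h) @[h --> 0] --> g t.
Proof.
move=> gd.
have : (fun h : R => g t + h *: dquot (g : R^o -> E) t 1 h) @ 0^' --> g t + 0 *: d.
  by apply: tvs_cvgD; [exact: cvg_cst|apply: tvs_cvgZ => //; exact: nbhs_dnbhs].
under eq_fun do rewrite -curve_dquotK; rewrite scale0r addr0.
move=> h W Wg.
have : \forall u \near (0:R)^', W (g (t + u)) by exact: h W Wg.
rewrite near_withinE; apply: filterS => u Wu; have [->|] := eqVneq u 0; last exact: Wu.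
by rewrite /= addr0; exact: nbhs_singleton.
Qed.

Lemma curve_der_continuous g t d : curve_der g t d -> g s @[s --> t] --> g t.
Proof.
move=> /curve_der_cvg0 h.
have k : s - t @[s --> t] --> 0.
  by rewrite -[X in _ --> X](subrr t); apply: cvgB; [exact: cvg_id|exact: cvg_cst].
have := cvg_comp _ _ k h; rewrite (_ : _ \o _ = g)//.
by apply/funext => s /=; rewrite addrC subrK.
Qed.

(** The real function [s |-> p (g s - g a - (s - a) *: v) - M * (s - a)] does not
    increase, since its increments are controlled by [p (g' s - v) - M]. *)
Lemma mean_value_le g a b p v M : cseminorm p -> a <= b ->
  (forall s, s \in `[a, b] -> exists2 d, curve_der g s d & p (d - v) <= M) ->
  p (g b - g a - (b - a) *: v) <= M * (b - a).
Proof.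
move=> ps ab gd.
pose f s := p (g s - g a - (s - a) *: v) - M * (s - a).
suff : f b <= f a by rewrite /f !subrr scale0r !subr0 mulr0 (cseminorm0 ps) subr0; lra.
apply: dini_nonincreasing ab _ _.
  apply: continuous_in_subspaceT => s /set_mem/= sab.
  have [d gd' _] := gd s sab.
  apply: cvgB.
    apply: (cseminorm_cvg ps); apply: tvs_cvgB.
      by apply: tvs_cvgB; [exact: curve_der_continuous gd'|exact: cvg_cst].
    apply: tvs_cvgZ; last exact: cvg_cst.
    by apply: cvgB; [exact: cvg_id|exact: cvg_cst].
  apply: cvgM; first exact: cvg_cst.
  by apply: cvgB; [exact: cvg_id|exact: cvg_cst].
move=> s sab e e0; have [d gd' pd] := gd s (subset_itv_oo_cc sab).
have := cseminorm_cvg_near ps (cvg_dnbhs_at_right gd') e0.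
move=> H; near=> h.
have h0 : 0 < h by near: h; exact: nbhs_right_gt.
have qh : p (dquot (g : R^o -> E) s 1 h - d) < e by near: h; exact: H.
set q := dquot _ _ _ _ in qh.
have qv : p (q - v) <= e + M.
  by have := cseminormD ps (q - d) (d - v); rewrite addrA subrK; lra.
have -> : f (s + h) = p ((g s - g a - (s - a) *: v) + h *: (q - v)) - M * (s + h - a).
  rewrite /f curve_dquotK -/q; congr (p _ - _).
  rewrite [s + h - a]addrAC scalerDl scalerBr opprD.
  by rewrite [RHS]addrACA; congr (_ + _); rewrite addrAC.
have := cseminormD ps (g s - g a - (s - a) *: v) (h *: (q - v)).
rewrite (cseminormZ ps) gtr0_norm// /f.
have : h * p (q - v) <= h * (e + M) by rewrite ler_pM2l.
lra.
Unshelve. all: by end_near. Qed.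

(** The form used for difference quotients, where [t] may have either sign. *)
Lemma mean_value_le0 g t p v M : cseminorm p ->
  (forall s, `|s| <= `|t| -> exists2 d, curve_der g s d & p (d - v) <= M) ->
  p (g t - g 0 - t *: v) <= M * `|t|.
Proof.
move=> ps gd; have [t0|t0] := leP 0 t.
  rewrite ger0_norm// -[t in X in p X]subr0 -[in leRHS](subr0 t).
  have := @mean_value_le g 0 t p v M ps t0; rewrite !subr0; apply => s.
  by rewrite in_itv/= => /andP[s0 st]; apply: gd; rewrite !ger0_norm.
have := @mean_value_le g t 0 p v M ps (ltW t0).
rewrite sub0r (ltr0_norm t0) scaleNr opprK => h.
rewrite -(cseminormN ps) !opprB addrC.
apply: h => s; rewrite in_itv/= => /andP[s0 st]; apply: gd.
by rewrite !ler0_norm// ?lerN2// ltW.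
Qed.

End Curves.

(** * Strict differentiability *)

Lemma dnbhs0M (R : realType) (a : R) : a != 0 -> t * a @[t --> (0:R)^'] --> (0:R)^'.
Proof.
move=> a0; rewrite -[X in _ --> X^'](mul0r a).
apply: continuous_injective_withinNx; first by apply: cvgM; [exact: cvg_id|exact: cvg_cst].
by move=> y; rewrite mul0r => /eqP; rewrite mulf_eq0 (negbTE a0) orbF => /eqP.
Qed.

Section StrictDerivative.
Context {R : realType}.

Section StrictAndHadamard.
Context {F E : tvsType R}.
Implicit Types (f : F -> E) (U : set F).

(** The difference quotient converges while the base point and the direction
    move too. Unlike [hadamard_der], this passes to partial maps and makes the
    derivative additive. *)
Definition strict_der f (x : F) (L : F -> E) : Prop := forall v,
  (fun z : (F * F) * R => dquot f z.1.1 z.1.2 z.2)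
    @ filter_prod (nbhs (x, v)) (0:R)^' --> L v.

(** Letting the direction vary is the least that makes the chain rule hold in
    spaces without a norm. *)
Definition hadamard_der f (x : F) (L : F -> E) : Prop := forall v,
  (fun z : F * R => dquot f x z.1 z.2) @ filter_prod (nbhs v) (0:R)^' --> L v.

Lemma strict_der_lim f x L : strict_der f x L ->
  forall (T : Type) (D : set_system T) {FD : Filter D}
    (y w : T -> F) (t : T -> R) v,
  y @ D --> x -> w @ D --> v -> t @ D --> 0^' ->
  dquot f (y s) (w s) (t s) @[s --> D] --> L v.
Proof.
move=> fL T D FD y w t v yx wv t0.
exact: (cvg_comp _ _ (cvg_pair (cvg_pair yx wv) t0) (fL v)).
Qed.

Lemma hadamard_der_lim f x L : hadamard_der f x L ->
  forall (T : Type) (D : set_system T) {FD : Filter D} (w : T -> F) (t : T -> R) v,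
  w @ D --> v -> t @ D --> 0^' -> dquot f x (w s) (t s) @[s --> D] --> L v.
Proof.
move=> fL T D FD w t v wv t0.
exact: (cvg_comp _ _ (cvg_pair wv t0) (fL v)).
Qed.

Lemma strict_hadamard f x L : strict_der f x L -> hadamard_der f x L.
Proof.
move=> fL v; apply: (strict_der_lim fL); first exact: cvg_cst.
  exact: cvg_fst.
exact: cvg_snd.
Qed.

Definition C1 U f : Prop :=
  [/\ open U, forall (x v : F), U x -> ddiff f x v &
      forall (x v : F), U x -> dder f z.1 z.2 @[z --> (x, v)] --> dder f x v].

Lemma ddiffP f x v : ddiff f x v -> dquot f x v @ 0^' --> dder f x v.
Proof. by move=> h; rewrite /dder; exact: (xgetPex 0 h). Qed.

Lemma line_curve_der f y w s : ddiff f (y + s *: w) w ->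
  curve_der (fun r => f (y + r *: w)) s (dder f (y + s *: w) w).
Proof.
move=> /ddiffP; rewrite /curve_der.
suff -> : dquot ((fun r : R => f (y + r *: w)) : R^o -> E) s 1 = dquot f (y + s *: w) w by [].
by apply/funext => h; rewrite curve_dquotE /dquot scalerDl addrA.
Qed.

(** Near [(x, v)] the directional derivatives along the segment from [y] to
    [y + t w] are all close to that of [f] at [x] along [v]; the mean value
    estimate transfers this to the difference quotient. *)
Lemma C1_strict_der U f x : C1 U f -> U x -> strict_der f x (dder f x).
Proof.
move=> [Uo fd fc] Ux v; apply: cvg_cseminorm => p ps e e0.
have e20 : 0 < e / 2 by rewrite divr_gt0.
pose good (z : F * F) := U z.1 /\ p (dder f z.1 z.2 - dder f x v) < e / 2.
have Hg : \forall z \near (x, v), good z.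
  apply: filterI.
    have : \forall y \near x, U y by exact: open_nbhs_nbhs.
    by apply: cvg_fst.
  exact: (cseminorm_cvg_near ps (fc x v Ux) e20).
have : (fun z : (F * F) * R => (z.1.1 + z.2 *: z.1.2, z.1.2)) @
    filter_prod (nbhs (x, v)) (nbhs (0:R)) --> (x + 0 *: v, v).
  apply: cvg_pair.
    apply: tvs_cvgD; first exact: (cvg_comp _ _ cvg_fst cvg_fst).
    apply: tvs_cvgZ; first exact: cvg_snd.
    exact: (cvg_comp _ _ cvg_fst cvg_snd).
  exact: (cvg_comp _ _ cvg_fst cvg_snd).
rewrite scale0r addr0 => /(_ _ Hg) [[A D] /= [xvA D0] AD].
have [d /= d0 dD] := (nbhs_ballP _ _).1 D0.
have Ht : \forall t \near (0:R)^', t != 0 /\ `|t| < d.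
  near=> t; split; near: t; first exact: nbhs_dnbhs_neq.
  by apply: nbhs_dnbhs; apply/nbhs_ballP; exists d => //= t; rewrite /ball/= sub0r normrN.
exists (A, [set t | t != 0 /\ `|t| < d]) => //=.
move=> [[y w] t] /= [Ayw [t0 td]].
have := @mean_value_le0 _ _ (fun s => f (y + s *: w)) t p (dder f x v) (e / 2) ps.
rewrite scale0r addr0 => H.
have {}H : p (f (y + t *: w) - f y - t *: dder f x v) <= e / 2 * `|t|.
  apply: H => s st.
  have [/= Us ps'] : good (y + s *: w, w).
    apply: (AD ((y, w), s)); split => //=; apply: dD => /=.
    by rewrite /ball/= sub0r normrN; exact: le_lt_trans td.
  exists (dder f (y + s *: w) w); last exact: ltW.
  by apply: line_curve_der; exact: fd.
have -> : dquot f y w t - dder f x v = t^-1 *: (f (y + t *: w) - f y - t *: dder f x v).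
  by rewrite [RHS]scalerBr scalerA mulVf// scale1r.
rewrite (cseminormZ ps) normfV ltr_pdivrMl ?normr_gt0//.
apply: le_lt_trans H _; rewrite mulrC ltr_pM2l ?normr_gt0//; lra.
Unshelve. all: by end_near. Qed.

Lemma hadamard_dder f x L v : hausdorff_space E -> hadamard_der f x L -> dder f x v = L v.
Proof.
move=> hE fL.
have h : dquot f x v @ (0:R)^' --> L v.
  by apply: (hadamard_der_lim fL) => //; exact: cvg_cst.
apply: (cvg_unique hE _ h); apply: ddiffP; by exists (L v).
Qed.

(** The increment along [t (v + w)] is the sum of an increment along [t v] at [x]
    and one along [t w] at the moved base point [x + t v]; strictness is what
    gives the limit of the second. *)
Lemma strict_derD f x L v w : hausdorff_space E -> strict_der f x L ->
  L (v + w) = L v + L w.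
Proof.
move=> hE fL.
have h1 : dquot f x (v + w) t @[t --> 0^'] --> L (v + w).
  by apply: (strict_der_lim fL) => //; exact: cvg_cst.
have h2 : dquot f x v t @[t --> 0^'] --> L v.
  by apply: (strict_der_lim fL) => //; exact: cvg_cst.
have h3 : dquot f (x + t *: v) w t @[t --> 0^'] --> L w.
  apply: (strict_der_lim fL) => //; last exact: cvg_cst.
  rewrite -[X in _ --> X]addr0 -(scale0r v); apply: tvs_cvgD; first exact: cvg_cst.
  by apply: tvs_cvgZ; [exact: nbhs_dnbhs|exact: cvg_cst].
apply: (cvg_unique hE h1).
suff -> : dquot f x (v + w) = (fun t => dquot f x v t + dquot f (x + t *: v) w t).
  exact: tvs_cvgD.
apply/funext => t; rewrite /dquot -scalerDr; congr (_ *: _).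
by rewrite [RHS]addrC addrA subrK scalerDr addrA.
Qed.

Lemma hadamard_derZ f x L a v : hausdorff_space E -> hadamard_der f x L ->
  L (a *: v) = a *: L v.
Proof.
move=> hE fL.
have h1 : dquot f x (a *: v) t @[t --> 0^'] --> L (a *: v).
  by apply: (hadamard_der_lim fL) => //; exact: cvg_cst.
apply: (cvg_unique hE h1).
have [->|a0] := eqVneq a 0.
  suff -> : dquot f x (0 *: v) = cst 0 by rewrite scale0r; exact: cvg_cst.
  by apply/funext => t; rewrite /dquot scale0r scaler0 addr0 subrr scaler0.
have h2 : dquot f x v (t * a) @[t --> 0^'] --> L v.
  apply: (hadamard_der_lim fL); first exact: cvg_cst.
  exact: dnbhs0M.
suff -> : dquot f x (a *: v) = (fun t => a *: dquot f x v (t * a)).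
  by apply: tvs_cvgZ => //; exact: cvg_cst.
apply/funext => t; by rewrite /dquot !scalerA invfM mulrCA mulfV// mulr1.
Qed.

End StrictAndHadamard.

Section Chain.
Context {F E H : tvsType R}.

(** Only the values on a neighborhood matter, because [x + t w] tends to [x]. *)
Lemma hadamard_der_near (f g : F -> E) x L : (\forall y \near x, f y = g y) ->
  hadamard_der f x L -> hadamard_der g x L.
Proof.
move=> fg fL v.
have : (fun z : F * R => x + z.2 *: z.1) @ filter_prod (nbhs v) (nbhs (0:R)) --> x + 0 *: v.
  apply: tvs_cvgD; first exact: cvg_cst.
  by apply: tvs_cvgZ; [exact: cvg_snd|exact: cvg_fst].
rewrite scale0r addr0 => /(_ _ fg) near_fg.
apply: cvg_trans (fL v); apply: near_eq_cvg.
have : \forall z \near filter_prod (nbhs v) (0:R)^', f (x + z.2 *: z.1) = g (x + z.2 *: z.1).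
  have c : (fun z : F * R => z) @ filter_prod (nbhs v) (0:R)^' `=>` filter_prod (nbhs v) (nbhs (0:R)).
    move=> Q [[A D] /= [vA D0] AD]; exists (A, D) => //; split => //.
    exact: nbhs_dnbhs.
  exact: (c _ near_fg).
apply: filterS => z fgz; rewrite /dquot fgz; congr (_ *: (_ - _)).
exact: (nbhs_singleton fg).
Qed.

(** The increment of [f] is [t] times its difference quotient, so the quotient of
    [g \o f] is a quotient of [g] along a convergent direction. *)
Lemma hadamard_der_comp (f : F -> E) (g : E -> H) x L M :
  hadamard_der f x L -> hadamard_der g (f x) M -> hadamard_der (g \o f) x (M \o L).
Proof.
move=> fL gM v.
have h : dquot g (f x) (dquot f x z.1 z.2) z.2 @[z --> filter_prod (nbhs v) (0:R)^'] --> M (L v).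
  by apply: (hadamard_der_lim gM); [exact: fL|exact: cvg_snd].
apply: cvg_trans h; apply: near_eq_cvg.
have : \forall z \near filter_prod (nbhs v) (0:R)^', z.2 != 0.
  have t0 : \forall t \near (0:R)^', t != 0 by exact: nbhs_dnbhs_neq.
  by exists (setT, [set t : R | t != 0]) => [|[w t] []//]; split; first exact: filterT.
by apply: filterS => -[w t] /= t0; rewrite /dquot/= -/(dquot f x w t) -dquotK.
Qed.

Lemma curve_der_comp (g : R -> E) (f : E -> H) t d L :
  curve_der g t d -> hadamard_der f (g t) L -> curve_der (f \o g) t (L d).
Proof.
move=> gd fL.
have h : dquot f (g t) (dquot (g : R^o -> E) t 1 h) h @[h --> 0^'] --> L d.
  exact: (hadamard_der_lim fL).
rewrite /curve_der; apply: cvg_trans h; apply: near_eq_cvg; apply: nearW => h.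
by rewrite [RHS]curve_dquotE /= [LHS]/dquot -curve_dquotK.
Qed.

End Chain.

End StrictDerivative.

(** * Smooth maps *)

Lemma ptws_cvg (I : Type) (F : topologicalType) (T : Type) (D : set_system T)
    {FD : Filter D} (f : T -> {ptws I -> F}) (l : {ptws I -> F}) :
  (forall i, f t i @[t --> D] --> l i) -> f @ D --> l.
Proof.
move=> h; apply/cvg_sup => i U.
have /= -> := @nbhsE (initial_topology (fun g : I -> F => g i)) l.
case=> B [[C oC <- Cl]] /filterS; apply.
by apply: (h i); exact: open_nbhs_nbhs.
Qed.

Lemma open_setX (S T : topologicalType) (A : set S) (B : set T) :
  open A -> open B -> open (A `*` B).
Proof.
move=> Ao Bo; rewrite openE => -[x y] [/= Ax By]; exists (A, B) => //=.
by split; exact: open_nbhs_nbhs.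
Qed.

Section SmoothMaps.
Context {R : realType}.

Section CnC1.
Context {F E : tvsType R}.
Implicit Types (f : F -> E) (U : set F).

Lemma Cn_continuous n U f : open U -> Cn n U f -> forall x, U x -> f @ x --> f x.
Proof.
move=> Uo [_ /(_ 0%N (leq0n _))].
rewrite continuous_open_subspace; last by apply: open_setX => //; exact: openT.
move=> fc x Ux; pose c : {ptws 'I_0 -> F} := fun=> 0.
have /fc : (x, c) \in U `*` setT by rewrite inE.
have xc : (fun y : F => (y, c)) @ x --> (x, c).
  apply: (@cvg_pair _ _ _ (nbhs x) (nbhs x) (nbhs c)); first exact: cvg_id.
  exact: (@cvg_cst _ c).
by move=> /(cvg_comp _ _ xc); rewrite /= /comp /= /image_mem enum_ord0.

Qed.

Lemma Cn_C1 n U f : open U -> Cn n.+1 U f -> C1 U f.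
Proof.
move=> Uo [fd fc]; split => // [x v Ux|x v Ux]; first exact: (fd [::] v x).
have := fc 1%N isT; rewrite continuous_open_subspace; last by apply: open_setX => //; exact: openT.
pose j (z : F * F) : F * {ptws 'I_1 -> F} := (z.1, fun=> z.2).
have /[swap]/[apply] : j (x, v) \in U `*` setT by rewrite inE.
have xc : j @ (x, v) --> j (x, v).
  apply: (@cvg_pair _ _ _ (nbhs (x, v)) (nbhs x) (nbhs (j (x, v)).2)).
    exact: cvg_fst.
  by apply: ptws_cvg => i; exact: cvg_snd.
by move=> /(cvg_comp _ _ xc); rewrite /= /comp /= /image_mem enum_ordSl enum_ord0.
Qed.

(** The direction [v] is frozen in the first slot of the second iterated
    derivative. *)
Lemma Cn_C1_dder n U f v : open U -> Cn n.+2 U f -> C1 U (fun x => dder f x v).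
Proof.
move=> Uo [fd fc]; split => // [x w Ux|x w Ux]; first exact: (fd [:: v] w x).
have := fc 2%N isT; rewrite continuous_open_subspace; last by apply: open_setX => //; exact: openT.
pose j (z : F * F) : F * {ptws 'I_2 -> F} :=
  (z.1, fun i => if i == ord0 then v else z.2).
have /[swap]/[apply] : j (x, w) \in U `*` setT by rewrite inE.
have xc : j @ (x, w) --> j (x, w).
  apply: (@cvg_pair _ _ _ (nbhs (x, w)) (nbhs x) (nbhs (j (x, w)).2)).
    exact: cvg_fst.
  apply: ptws_cvg => i /=; case: ifP => _; [exact: cvg_cst|exact: cvg_snd].
by move=> /(cvg_comp _ _ xc); rewrite /= /comp /= /image_mem !enum_ordSl enum_ord0.
Qed.

Lemma C1_hadamard U f x : C1 U f -> U x -> hadamard_der f x (dder f x).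
Proof. by move=> fC Ux; apply: strict_hadamard; exact: C1_strict_der fC Ux. Qed.

Hypothesis hE : hausdorff_space E.

Lemma C1_dderD U f x v w : C1 U f -> U x -> dder f x (v + w) = dder f x v + dder f x w.
Proof. by move=> fC Ux; apply: (strict_derD _ _ hE (C1_strict_der fC Ux)). Qed.

Lemma C1_dderZ U f x a v : C1 U f -> U x -> dder f x (a *: v) = a *: dder f x v.
Proof. by move=> fC Ux; apply: (hadamard_derZ _ _ hE (C1_hadamard fC Ux)). Qed.

Lemma C1_dderN U f x v : C1 U f -> U x -> dder f x (- v) = - dder f x v.
Proof. by move=> fC Ux; rewrite -scaleN1r (C1_dderZ _ _ fC Ux) scaleN1r. Qed.

(** As a function of the step along [v], the second difference has derivative
    [t] times a difference quotient of [dder f _ v] along [w]; strict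
    differentiability makes the latter uniformly close to its limit. *)
Lemma second_difference U f x v w : C1 U f -> C1 U (fun y => dder f y v) -> U x ->
  t^-1 *: (t^-1 *: (f (x + t *: w + t *: v) - f (x + t *: v) - (f (x + t *: w) - f x)))
    @[t --> (0:R)^'] --> dder (fun y => dder f y v) x w.
Proof.
move=> fC gC Ux; set g := fun y => dder f y v.
have gs := C1_strict_der gC Ux.
apply: cvg_cseminorm => p ps e e0.
have e20 : 0 < e / 2 by rewrite divr_gt0.
case: (fC) => Uo fd _.
(* the points of the parallelogram spanned by [t v] and [t w] lie in [U] *)
have Hin : \forall z \near nbhs ((0:R), (0:R)), U (x + z.1 *: w + z.2 *: v).
  have : x + z.1 *: w + z.2 *: v @[z --> ((0:R), (0:R))] --> x + (0:R) *: w + (0:R) *: v.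
    apply: tvs_cvgD; first apply: tvs_cvgD.
    - exact: cvg_cst.
    - by apply: tvs_cvgZ; [exact: cvg_fst|exact: cvg_cst].
    - by apply: tvs_cvgZ; [exact: cvg_snd|exact: cvg_cst].
  by rewrite !scale0r !addr0; apply; exact: open_nbhs_nbhs.
have Hq : \forall z \near filter_prod (nbhs (0:R)) (0:R)^',
    p (dquot g (x + z.1 *: v) w z.2 - dder g x w) < e / 2.
  apply: (cseminorm_cvg_near ps) => //.
  apply: (strict_der_lim gs); [|exact: cvg_cst|exact: cvg_snd].
  rewrite -[X in _ --> X]addr0 -(scale0r v); apply: tvs_cvgD; first exact: cvg_cst.
  by apply: tvs_cvgZ; [exact: cvg_fst|exact: cvg_cst].
have [d d0 dP] : exists2 d : R, 0 < d & forall s t, `|s| < d -> `|t| < d -> t != 0 ->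
    [/\ U (x + s *: v), U (x + t *: w + s *: v) &
        p (dquot g (x + s *: v) w t - dder g x w) < e / 2].
  case: Hin => -[A B] /= [/nbhs_ballP[a /= a0 aA] /nbhs_ballP[b /= b0 bB]] ABU.
  case: Hq => -[A' B'] /= [/nbhs_ballP[a' /= a'0 aA'] /nbhs_ballP[b' /= b'0 bB']] ABq.
  exists (Num.min (Num.min a b) (Num.min a' b')); first by rewrite !lt_min a0 b0 a'0.
  move=> s t; rewrite !lt_min => /andP[/andP[sa sb] /andP[sa' sb']].
  move=> /andP[/andP[ta tb] /andP[ta' tb']] t0; split.
  - have := ABU (0, s); rewrite /= scale0r addr0; apply; split.
      by apply: aA; exact: ballxx.
    by apply: bB; rewrite /ball/= sub0r normrN.
  - apply: (ABU (t, s)); split => /=.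
      by apply: aA; rewrite /ball/= sub0r normrN.
    by apply: bB; rewrite /ball/= sub0r normrN.
  - apply: (ABq (s, t)); split => /=.
      by apply: aA'; rewrite /ball/= sub0r normrN.
    by apply: bB' => //=; rewrite /ball/= sub0r normrN.
have Hd : \forall t \near (0:R)^', t != 0 /\ `|t| < d.
  near=> t; split; near: t; first exact: nbhs_dnbhs_neq.
  by apply: nbhs_dnbhs; apply/nbhs_ballP; exists d => //= t; rewrite /ball/= sub0r normrN.
apply: filterS Hd => t [t0 td].
pose gam s := f (x + t *: w + s *: v) - f (x + s *: v).
have : p (gam t - gam 0 - t *: (t *: dder g x w)) <= `|t| * (e / 2) * `|t|.
  apply: (mean_value_le0 ps) => s st.
  have sd : `|s| < d by exact: le_lt_trans td.
  have [U1 U2 pq] := dP s t sd td t0.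
  exists (g (x + t *: w + s *: v) - g (x + s *: v)).
    by apply: curve_derB; apply: line_curve_der; exact: fd.
  have -> : g (x + t *: w + s *: v) - g (x + s *: v) = t *: dquot g (x + s *: v) w t.
    by rewrite /dquot scalerA mulfV// scale1r [x + t *: w + _]addrAC.
  by rewrite -scalerBr (cseminormZ ps) ler_pM2l ?normr_gt0// ltW.
rewrite /gam scale0r !addr0 => H.
set D := (X in p (X - _)) in H.
have -> : t^-1 *: (t^-1 *: D) - dder g x w = t^-1 *: (t^-1 *: (D - t *: (t *: dder g x w))).
  by rewrite !scalerBr !scalerA mulrA mulfVK// mulVf// scale1r.
rewrite !(cseminormZ ps) !normfV ltr_pdivrMl ?normr_gt0// ltr_pdivrMl ?normr_gt0//.
apply: le_lt_trans H _; rewrite mulrC; rewrite !ltr_pM2l ?normr_gt0//; lra.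
Unshelve. all: by end_near. Qed.

(** The second difference quotient is symmetric in [v] and [w], and its limit
    can be read off in both orders. *)
Lemma schwarz U f x v w : C1 U f -> (forall v, C1 U (fun y => dder f y v)) -> U x ->
  dder (fun y => dder f y v) x w = dder (fun y => dder f y w) x v.
Proof.
move=> fC gC Ux.
have h1 := @second_difference U f x v w fC (gC v) Ux.
have h2 := @second_difference U f x w v fC (gC w) Ux.
apply: (cvg_unique hE h1); move: h2.
suff -> : (fun t => t^-1 *: (t^-1 *: (f (x + t *: w + t *: v) - f (x + t *: v) - (f (x + t *: w) - f x))))
  = (fun t => t^-1 *: (t^-1 *: (f (x + t *: v + t *: w) - f (x + t *: w) - (f (x + t *: v) - f x)))) by [].
apply/funext => t; do 2 congr (_ *: _).
rewrite [x + t *: v + _]addrAC !opprB.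
by rewrite [LHS]addrACA [RHS]addrACA; congr (_ + _); rewrite [RHS]addrC.
Qed.

End CnC1.
End SmoothMaps.

(** * Tangent maps of a Lie group *)

Lemma open_within_preimage (S T : topologicalType) (U : set S) (f : S -> T) (V : set T) :
  open U -> {within U, continuous f} -> open V -> open (U `&` f @^-1` V).
Proof.
move=> Uo; rewrite continuous_open_subspace// => fc Vo.
rewrite openE => x [Ux Vx]; apply: filterI; first exact: open_nbhs_nbhs.
by apply: (fc x (mem_set Ux)); exact: open_nbhs_nbhs.
Qed.

Section Partial.
Context {R : realType} {F1 F2 E : tvsType R}.
Implicit Types (f : F1 * F2 -> E).

Lemma strict_der_fst f x b L : strict_der f (x, b) L ->
  strict_der (fun y => f (y, b)) x (fun v => L (v, 0)).
Proof.
move=> fL v.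
suff -> : (fun z : F1 * F1 * R => dquot (fun y => f (y, b)) z.1.1 z.1.2 z.2) =
    (fun z => dquot f (z.1.1, b) (z.1.2, 0) z.2).
  apply: (strict_der_lim fL); last exact: cvg_snd.
    by apply: cvg_pair; [exact: (cvg_comp _ _ cvg_fst cvg_fst)|exact: cvg_cst].
  by apply: cvg_pair; [exact: (cvg_comp _ _ cvg_fst cvg_snd)|exact: cvg_cst].
apply/funext => -[[y w] t] /=; rewrite /dquot; do 3 f_equal.
by congr (_, _); rewrite /= ?scaler0 ?addr0.
Qed.

Lemma strict_der_snd f a y L : strict_der f (a, y) L ->
  strict_der (fun y => f (a, y)) y (fun v => L (0, v)).
Proof.
move=> fL v.
suff -> : (fun z : F2 * F2 * R => dquot (fun y => f (a, y)) z.1.1 z.1.2 z.2) =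
    (fun z => dquot f (a, z.1.1) (0, z.1.2) z.2).
  apply: (strict_der_lim fL); last exact: cvg_snd.
    by apply: cvg_pair; [exact: cvg_cst|exact: (cvg_comp _ _ cvg_fst cvg_fst)].
  by apply: cvg_pair; [exact: cvg_cst|exact: (cvg_comp _ _ cvg_fst cvg_snd)].
apply/funext => -[[x w] t] /=; rewrite /dquot; do 3 f_equal.
by congr (_, _); rewrite /= ?scaler0 ?addr0.
Qed.

End Partial.

Section Tangents.
Context {R : realType} {E : tvsType R} {G : milnorLieGroupType E}.
Hypothesis hE : hausdorff_space E.
Implicit Types (c : chart E G) (f : G -> G) (g h : G) (L : E -> E).

Lemma chart_cvg c g : cdom c g -> c @ g --> c g.
Proof.
have := @cfun_continuous _ _ _ c; rewrite continuous_open_subspace; last exact: cdom_open.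
by move=> cc gc; apply: cc; exact: mem_set.
Qed.

Lemma cinv_cvg c x : cimg c x -> cinv c @ x --> cinv c x.
Proof.
have := @cinv_continuous _ _ _ c; rewrite continuous_open_subspace; last exact: cimg_open.
by move=> cc xc; apply: cc; exact: mem_set.
Qed.

Lemma cdom_near c g : cdom c g -> \forall h \near g, cdom c h.
Proof. by move=> cg; apply: open_nbhs_nbhs; split => //; exact: cdom_open. Qed.

Lemma cimg_near c x : cimg c x -> \forall y \near x, cimg c y.
Proof. by move=> cx; apply: open_nbhs_nbhs; split => //; exact: cimg_open. Qed.

Lemma chart_at_atlas g : (atlas : set (chart E G)) (chart_at g).
Proof. by rewrite /chart_at; case: cid2. Qed.

Lemma chart_at_dom g : cdom (chart_at g) g.
Proof. by rewrite /chart_at; case: cid2. Qed.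

Definition linear_map L := forall a v w, L (a *: v + w) = a *: L v + L w.

(** The tangent map at [g] of a map of [G], in coordinates: [c] is used at [g]
    and [c'] at [f g]. Linearity and continuity at [g] are included so that they
    propagate along compositions. *)
Definition has_tangent c c' f g L : Prop :=
  [/\ cdom c g, cdom c' (f g), f @ g --> f g,
      hadamard_der (c' \o f \o cinv c) (c g) L & linear_map L].

Lemma has_tangentE c c' f g L v : has_tangent c c' f g L ->
  dder (c' \o f \o cinv c) (c g) v = L v.
Proof. by move=> [_ _ _ fL _]; exact: hadamard_dder. Qed.

Lemma has_tangent_unique c c' f g L L' : has_tangent c c' f g L ->
  has_tangent c c' f g L' -> forall v, L v = L' v.
Proof. by move=> /has_tangentE fL /has_tangentE fL' v; rewrite -fL fL'. Qed.

(** Continuity of [f] at [g] ensures that near [g] the intermediate chart can be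
    inserted. *)
Lemma has_tangent_comp c c' c'' f f' g L L' :
  has_tangent c c' f g L -> has_tangent c' c'' f' (f g) L' ->
  has_tangent c c'' (f' \o f) g (L' \o L).
Proof.
move=> [cg cfg fg fL Ll] [_ cffg ffg fL' Ll']; split => //.
- exact: cvg_comp fg ffg.
- have h : hadamard_der ((c'' \o f' \o cinv c') \o (c' \o f \o cinv c)) (c g) (L' \o L).
    apply: hadamard_der_comp => //=.
    by rewrite (cfunK cg).
  apply: hadamard_der_near h.
  have cg' : cinv c @ (c g) --> g.
    by have := cinv_cvg (cfun_img cg); rewrite (cfunK cg).
  have : \forall y \near c g, cdom c' (f (cinv c y)).
    exact: (cvg_comp _ _ cg' fg _ (cdom_near cfg)).
  by apply: filterS => y /= cfy; rewrite (cfunK cfy).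
- by move=> a v w /=; rewrite Ll Ll'.
Qed.

Lemma has_tangent_id c g : cdom c g -> has_tangent c c id g id.
Proof.
move=> cg; split => //.
apply: (@hadamard_der_near _ _ _ id).
  apply: filterS (cimg_near (cfun_img cg)) => y cy /=.
  by rewrite (cinvK cy).
move=> v; apply: cvg_trans (@cvg_fst _ _ (nbhs v) (dnbhs (0:R)) _).
apply: near_eq_cvg.
have t0 : \forall t \near (0:R)^', t != 0 by exact: nbhs_dnbhs_neq.
exists (setT, [set t : R | t != 0]) => [|[w t] [/= _ tn0]]; first by split; first exact: filterT.
by rewrite /dquot [_ + _ - _]addrAC subrr add0r scalerA mulVf// scale1r.
Qed.

Lemma C1_linear U (f : E -> E) x : C1 U f -> U x -> linear_map (dder f x).
Proof.
by move=> fC Ux a v w; rewrite (C1_dderD hE _ _ fC Ux) (C1_dderZ hE _ _ fC Ux).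
Qed.

Lemma transition_open c c' : open (cimg c `&` cinv c @^-1` cdom c').
Proof.
apply: open_within_preimage; [exact: cimg_open|exact: cinv_continuous|exact: cdom_open].
Qed.

Lemma transition_C1 c c' : smooth_transition c c' ->
  C1 (cimg c `&` cinv c @^-1` cdom c') (c' \o cinv c).
Proof. by move=> /(_ 1%N); apply: Cn_C1; exact: transition_open. Qed.

Lemma transition_tangent c c' g : smooth_transition c c' -> cdom c g -> cdom c' g ->
  has_tangent c c' id g (dder (c' \o cinv c) (c g)).
Proof.
move=> cc' cg c'g; have C := transition_C1 cc'.
have Ug : (cimg c `&` cinv c @^-1` cdom c') (c g).
  by split; [exact: cfun_img|rewrite /= (cfunK cg)].
split => //; first exact: (C1_hadamard C).
exact: (C1_linear C).
Qed.

Definition chart_mul c c' c'' (z : E * E) : E := c'' (cinv c z.1 * cinv c' z.2)%g.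

Definition chart_mul_dom c c' c'' : set (E * E) :=
  cimg c `*` cimg c' `&` [set z | cdom c'' (cinv c z.1 * cinv c' z.2)%g].

Section ChartMul.
Variables c c' c'' : chart E G.
Hypotheses (ac : atlas c) (ac' : atlas c') (ac'' : atlas c'').

Lemma chart_mul_open : open (chart_mul_dom c c' c'').
Proof.
have [mc _] := mul_smooth _ _ ac ac' 0%N.
apply: open_within_preimage => //; last exact: cdom_open.
by apply: open_setX; exact: cimg_open.
Qed.

Lemma chart_mul_C1 : C1 (chart_mul_dom c c' c'') (chart_mul c c' c'').
Proof.
have [_ /(_ _ ac'')] := mul_smooth _ _ ac ac' 1%N.
by apply: Cn_C1; exact: chart_mul_open.
Qed.

Lemma chart_mul_C2 v :
  C1 (chart_mul_dom c c' c'') (fun z => dder (chart_mul c c' c'') z v).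
Proof.
have [_ /(_ _ ac'')] := mul_smooth _ _ ac ac' 2%N.
by apply: Cn_C1_dder; exact: chart_mul_open.
Qed.

Lemma chart_mul_domP g h : cdom c g -> cdom c' h -> cdom c'' (g * h)%g ->
  chart_mul_dom c c' c'' (c g, c' h).
Proof.
move=> cg ch cgh; split; first by split; exact: cfun_img.
by rewrite /= (cfunK cg) (cfunK ch).
Qed.

End ChartMul.

(** The smoothness axiom speaks of charts only; continuity of the multiplication
    for arbitrary filters is recovered by reading [u] and [v] in charts, which
    is possible eventually. *)
Lemma mulg_cvg (T : Type) (D : set_system T) {FD : Filter D} (u v : T -> G) g h :
  u @ D --> g -> v @ D --> h -> (u t * v t)%g @[t --> D] --> (g * h)%g.
Proof.
move=> ug vh; set c := chart_at g; set c' := chart_at h.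
have [mc _] := mul_smooth _ _ (chart_at_atlas g) (chart_at_atlas h) 0%N.
rewrite continuous_open_subspace in mc; last by apply: open_setX; exact: cimg_open.
have cg := chart_at_dom g; have ch := chart_at_dom h.
have /mc : (c g, c' h) \in cimg c `*` cimg c' by rewrite inE; split; exact: cfun_img.
have h1 : (fun t => (c (u t), c' (v t))) @ D --> (c g, c' h).
  by apply: cvg_pair; [exact: cvg_comp ug (chart_cvg cg)|exact: cvg_comp vh (chart_cvg ch)].
move=> /(cvg_comp _ _ h1); rewrite /= (cfunK cg) (cfunK ch).
apply: cvg_trans; apply: near_eq_cvg.
have cu : \forall t \near D, cdom c (u t) by exact: ug _ (cdom_near cg).
have cv : \forall t \near D, cdom c' (v t) by exact: vh _ (cdom_near ch).
by apply: filterS2 cu cv => t cut cvt /=; rewrite (cfunK cut) (cfunK cvt).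
Qed.

Lemma invg_cvg (T : Type) (D : set_system T) {FD : Filter D} (u : T -> G) g :
  u @ D --> g -> (u t)^-1%g @[t --> D] --> g^-1%g.
Proof.
move=> ug; set c := chart_at g.
have [mc _] := inv_smooth _ (chart_at_atlas g) 0%N.
rewrite continuous_open_subspace in mc; last exact: cimg_open.
have cg := chart_at_dom g.
have /mc : c g \in cimg c by rewrite inE; exact: cfun_img.
have h1 := cvg_comp _ _ ug (chart_cvg cg).
move=> /(cvg_comp _ _ h1); rewrite /= (cfunK cg).
apply: cvg_trans; apply: near_eq_cvg.
have cu : \forall t \near D, cdom c (u t) by exact: ug _ (cdom_near cg).
by apply: filterS cu => t cut /=; rewrite (cfunK cut).
Qed.

(** Translations are the partial maps of the multiplication read in charts, so
    their tangent maps are its partial derivatives. *)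
Lemma mulr_tangent c c' c'' g h : atlas c -> atlas c' -> atlas c'' ->
  cdom c g -> cdom c' h -> cdom c'' (g * h)%g ->
  has_tangent c c'' (fun k => k * h)%g g (fun v => dder (chart_mul c c' c'') (c g, c' h) (v, 0)).
Proof.
move=> ac ac' ac'' cg ch cgh.
have C := chart_mul_C1 ac ac' ac''; have U := chart_mul_domP cg ch cgh.
split => //.
- by apply: mulg_cvg; [exact: cvg_id|exact: cvg_cst].
- have := strict_hadamard (strict_der_fst (C1_strict_der C U)).
  apply: hadamard_der_near; apply: nearW => y.
  by rewrite /chart_mul /= (cfunK ch).
- move=> a v w; rewrite -(C1_dderZ hE _ _ C U) -(C1_dderD hE _ _ C U).
  by congr (dder _ _ _); congr (_, _); rewrite /= ?scaler0 ?addr0.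
Qed.

Lemma mull_tangent c c' c'' g h : atlas c -> atlas c' -> atlas c'' ->
  cdom c g -> cdom c' h -> cdom c'' (g * h)%g ->
  has_tangent c' c'' (fun k => g * k)%g h (fun v => dder (chart_mul c c' c'') (c g, c' h) (0, v)).
Proof.
move=> ac ac' ac'' cg ch cgh.
have C := chart_mul_C1 ac ac' ac''; have U := chart_mul_domP cg ch cgh.
split => //.
- by apply: mulg_cvg; [exact: cvg_cst|exact: cvg_id].
- have := strict_hadamard (strict_der_snd (C1_strict_der C U)).
  apply: hadamard_der_near; apply: nearW => y.
  by rewrite /chart_mul /= (cfunK cg).
- move=> a v w; rewrite -(C1_dderZ hE _ _ C U) -(C1_dderD hE _ _ C U).
  by congr (dder _ _ _); congr (_, _); rewrite /= ?scaler0 ?addr0.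
Qed.

End Tangents.

(** * The adjoint action and the bracket *)

Section Adjoint.
Context {R : realType} {E : tvsType R} {G : milnorLieGroupType E}.
Hypothesis hE : hausdorff_space E.
Implicit Types (g : G) (X Y Z : liealg G).

Let c : chart E G := chart_at 1%g.
Let x0 : E := c 1%g.
Let ac : atlas c := chart_at_atlas 1%g.
Let c1 : cdom c 1%g := chart_at_dom 1%g.

(** Writing the conjugation as a right translation after a left one gives its
    differentiability; the chart at [g * 1 * g^-1] is the chart at [1]. *)
Lemma has_tangent_Ad g : has_tangent c c (fun h => g * h * g^-1)%g 1%g (@Ad _ _ _ g).
Proof.
have aux L : has_tangent c c (fun h => g * h * g^-1)%g 1%g L ->
    has_tangent c c (fun h => g * h * g^-1)%g 1%g (@Ad _ _ G g).
  move=> h; suff -> : @Ad _ _ G g = L by [].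
  apply/funext => X; rewrite -(has_tangentE hE X h).
  by rewrite /Ad /tmap mulg1 mulgV.
have dg1 : cdom (chart_at g) (g * 1)%g by rewrite mulg1; exact: chart_at_dom.
have dgV : cdom c (g * 1 * g^-1)%g by rewrite mulg1 mulgV.
have h1 := mull_tangent hE (chart_at_atlas g) ac (chart_at_atlas g) (chart_at_dom g) c1 dg1.
have h2 := mulr_tangent hE (chart_at_atlas g) (chart_at_atlas g^-1%g) ac dg1 (chart_at_dom g^-1%g) dgV.
apply: aux (has_tangent_comp h1 h2).
Qed.

Lemma Ad_eq g L : has_tangent c c (fun h => g * h * g^-1)%g 1%g L -> Ad g =1 L.
Proof. exact: (has_tangent_unique hE (has_tangent_Ad g)). Qed.

Lemma Ad_linear g : linear_map (@Ad _ _ G g).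
Proof. by case: (has_tangent_Ad g). Qed.

Lemma Ad1 X : Ad 1%g X = X.
Proof.
apply: (Ad_eq (L := id)); have := has_tangent_id c1.
by congr (has_tangent _ _ _ _ _); apply/funext => h; rewrite mul1g invg1 mulg1.
Qed.

Lemma AdM g (h : G) X : Ad (g * h)%g X = Ad g (Ad h X).
Proof.
apply: (Ad_eq (L := @Ad _ _ G g \o @Ad _ _ G h)).
have := has_tangent_Ad g; rewrite -[X in has_tangent _ _ _ X _](mulgV h) -[h in X in (X * _)%g]mulg1.
move=> /(has_tangent_comp (has_tangent_Ad h)).
congr (has_tangent _ _ _ _ _); apply/funext => k /=.
by rewrite invgM !mulgA.
Qed.

Let m := chart_mul c c c.
Let U := chart_mul_dom c c c.
Let mC1 : C1 U m := chart_mul_C1 ac ac ac.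
Let mC2 v : C1 U (fun z => dder m z v) := chart_mul_C2 ac ac ac v.

Let U0 : U (x0, x0).
Proof. by apply: chart_mul_domP => //; rewrite mulg1. Qed.

(** For [g] close to [1] the conjugation can be computed entirely in the chart at
    [1], without the chart at [g], which depends on [g] in an uncontrolled way. *)
Lemma Ad_chart_mul g Z : cdom c g -> cdom c g^-1%g ->
  Ad g Z = dder m (c g, c g^-1%g) (dder m (c g, x0) (0, Z), 0).
Proof.
move=> cg cgV.
have cg1 : cdom c (g * 1)%g by rewrite mulg1.
have h1 := mull_tangent hE ac ac ac cg c1 cg1.
have cgg : cdom c (g * 1 * g^-1)%g by rewrite mulg1 mulgV.
have h2 := mulr_tangent hE ac ac ac cg1 cgV cgg.
have := Ad_eq (has_tangent_comp h1 h2) Z.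
by rewrite /= mulg1.
Qed.

(** The tangent map of the right translation by [g^-1] undoes that of the right
    translation by [g]. Subtracting this from the formula for [Ad g Z] produces a
    difference quotient inside a single derivative of [m]. *)
Lemma mulr_cancel g Z : cdom c g -> cdom c g^-1%g ->
  dder m (c g, c g^-1%g) (dder m (x0, c g) (Z, 0), 0) = Z.
Proof.
move=> cg cgV.
have cg1 : cdom c (1 * g)%g by rewrite mul1g.
have h1 := mulr_tangent hE ac ac ac c1 cg cg1.
have cgg : cdom c (1 * g * g^-1)%g by rewrite mul1g mulgV.
have h2 := mulr_tangent hE ac ac ac cg1 cgV cgg.
have := has_tangent_comp h1 h2.
rewrite (_ : _ \o _ = id); last by apply/funext => h /=; rewrite mulgK.
move=> /(has_tangent_unique hE (has_tangent_id c1)) /(_ Z) /=.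
by rewrite mul1g.
Qed.

Lemma chart_mul_1l v : dder m (x0, x0) (0, v) = v.
Proof.
have c11 : cdom c (1 * 1)%g by rewrite mulg1.
have := mull_tangent hE ac ac ac c1 c1 c11.
rewrite (_ : (fun k => 1 * k)%g = id); last by apply/funext => k; rewrite mul1g.
by move=> /(has_tangent_unique hE (has_tangent_id c1)) /(_ v).
Qed.

Lemma chart_mul_1r v : dder m (x0, x0) (v, 0) = v.
Proof.
have c11 : cdom c (1 * 1)%g by rewrite mulg1.
have := mulr_tangent hE ac ac ac c1 c1 c11.
rewrite (_ : (fun k => k * 1)%g = id); last by apply/funext => k; rewrite mulg1.
by move=> /(has_tangent_unique hE (has_tangent_id c1)) /(_ v).
Qed.

Lemma left_invariant_coordE X x : cimg c x ->
  left_invariant_coord X x = dder m (x, x0) (0, X).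
Proof.
move=> cx; set g := cinv c x.
have cg : cdom c g by exact: cinv_dom.
have cg1 : cdom c (g * 1)%g by rewrite mulg1.
have xg : x = c g by rewrite /g (cinvK cx).
have h1 := mull_tangent hE ac ac ac cg c1 cg1.
have dg1 : cdom (chart_at g) (g * 1)%g by rewrite mulg1; exact: chart_at_dom.
have h2 := mull_tangent hE ac ac (chart_at_atlas g) cg c1 dg1.
have h3 := transition_tangent hE (atlas_compatible _ _ (chart_at_atlas g) ac)
  (chart_at_dom g) cg.
rewrite -[g in has_tangent _ _ _ g _]mulg1 in h3.
have := has_tangent_unique hE h1 (has_tangent_comp h2 h3) X.
rewrite /= xg => ->.
rewrite -(has_tangentE hE X h2).
by rewrite /left_invariant_coord /= /dchart /left_invariant /tmap -xg -/c -/g mulg1.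
Qed.

(** In the chart at [1], the left invariant field of [X] is the second partial
    derivative [x |-> dder m (x, x0) (0, X)]. One of the two terms of the
    commutator is rewritten by the symmetry of second derivatives. *)
Lemma bracketE X Z : bracket X Z =
  dder (fun z => dder m z (0, Z)) (x0, x0) (X, 0) -
  dder (fun z => dder m z (Z, 0)) (x0, x0) (0, X).
Proof.
have D Y v : dder (left_invariant_coord Y) x0 v =
    dder (fun z => dder m z (0, Y)) (x0, x0) (v, 0).
  have hq := strict_hadamard (strict_der_fst (C1_strict_der (mC2 (0, Y)) U0)).
  have := hadamard_dder v hE (hadamard_der_near _ hq); apply.
  by apply: filterS (cimg_near (cfun_img c1)) => x cx; rewrite left_invariant_coordE.
have V Y : left_invariant_coord Y x0 = Y.
  by rewrite left_invariant_coordE ?chart_mul_1l//; exact: cfun_img.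
have DV Y Y' : dder (left_invariant_coord Y) x0 (left_invariant_coord Y' x0) =
    dder (fun z => dder m z (0, Y)) (x0, x0) (Y', 0).
  by rewrite V; exact: D.
have S := schwarz hE (0, X) (Z, 0) mC1 mC2 U0.
exact: (f_equal2 (fun a b => a - b) (DV Z X) (etrans (DV X Z) S)).
Qed.

(** With [x_s = c (nu s)], [y_s = c (nu s)^-1], [q x = dder m (x, x0) (0, Z)] and
    [r x = dder m (x0, x) (Z, 0)], one has
      [Ad (nu s) Z - Z = dder m (x_s, y_s) (q x_s - r x_s, 0)].
    The difference quotient of [q - r] along [x_s] converges by the chain rule,
    and [dder m] is jointly continuous with [dder m (x0, x0) (W, 0) = W]. *)
Lemma Ad_curve_der_at1 (nu : R -> G) t X Z :
  nu t = 1%g -> nu @ t --> (1%g : G) -> curve_der (c \o nu) t X ->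
  curve_der (fun s => Ad (nu s) Z : E) t (bracket X Z).
Proof.
move=> nut nuc nud.
pose nuh (h : R) := nu (t + h).
have nuh1 : nuh h @[h --> (0:R)^'] --> (1%g : G).
  have : t + h @[h --> (0:R)^'] --> t + 0.
    by apply: cvgD; [exact: cvg_cst|exact: nbhs_dnbhs].
  by rewrite addr0 => ht; exact: (cvg_comp _ _ ht nuc).
have xh : c (nuh h) @[h --> (0:R)^'] --> x0 by apply: (cvg_comp _ _ nuh1); exact: chart_cvg.
have nuhV : (nuh h)^-1%g @[h --> (0:R)^'] --> (1%g : G).
  by rewrite -[X in _ --> X]invg1; exact: invg_cvg.
have yh : c (nuh h)^-1%g @[h --> (0:R)^'] --> x0 by apply: (cvg_comp _ _ nuhV); exact: chart_cvg.
rewrite bracketE.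
pose q x := dder m (x, x0) (0, Z).
pose r x := dder m (x0, x) (Z, 0).
have qd : curve_der (q \o (c \o nu)) t (dder (fun z => dder m z (0, Z)) (x0, x0) (X, 0)).
  have hq : hadamard_der q ((c \o nu) t) (fun v => dder (fun z => dder m z (0, Z)) (x0, x0) (v, 0)).
    rewrite /= nut; exact: strict_hadamard (strict_der_fst (C1_strict_der (mC2 (0, Z)) U0)).
  exact: (curve_der_comp nud hq).
have rd : curve_der (r \o (c \o nu)) t (dder (fun z => dder m z (Z, 0)) (x0, x0) (0, X)).
  have hr : hadamard_der r ((c \o nu) t) (fun v => dder (fun z => dder m z (Z, 0)) (x0, x0) (0, v)).
    rewrite /= nut; exact: strict_hadamard (strict_der_snd (C1_strict_der (mC2 (Z, 0)) U0)).
  exact: (curve_der_comp nud hr).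
have := curve_derB qd rd; set W := _ - _ => Wd.
pose w (h : R) := dquot ((fun s => (q \o (c \o nu)) s - (r \o (c \o nu)) s) : R^o -> E) t 1 h.
have lim : dder m (c (nuh h), c (nuh h)^-1%g) (w h, 0) @[h --> (0:R)^'] --> dder m (x0, x0) (W, 0).
  case: mC1 => _ _ /(_ (x0, x0) (W, 0) U0) mc.
  have h1 : (fun h => ((c (nuh h), c (nuh h)^-1%g), (w h, 0 : E))) @ (0:R)^' --> ((x0, x0), (W, 0 : E)).
    apply: (@cvg_pair _ _ _ _ (nbhs (x0, x0)) (nbhs (W, 0 : E))).
      exact: (@cvg_pair _ _ _ _ (nbhs x0) (nbhs x0)).
    by apply: (@cvg_pair _ _ _ _ (nbhs W) (nbhs (0 : E))) => //; exact: cvg_cst.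
  exact: (cvg_comp _ _ h1 mc).
rewrite chart_mul_1r in lim.
apply: cvg_trans lim; apply: near_eq_cvg.
have cu : \forall h \near (0:R)^', cdom c (nuh h) by exact: nuh1 _ (cdom_near c1).
have cv : \forall h \near (0:R)^', cdom c (nuh h)^-1%g by exact: nuhV _ (cdom_near c1).
apply: filterS2 cu cv => h cg cgV.
rewrite [RHS]curve_dquotE nut Ad1 -/(nuh h).
have Uh : U (c (nuh h), c (nuh h)^-1%g) by apply: chart_mul_domP; rewrite ?mulgV.
rewrite -[X in _ = _ *: (_ - X)](mulr_cancel Z cg cgV) (Ad_chart_mul Z cg cgV).
rewrite -[in RHS](C1_dderN hE _ mC1 Uh) -(C1_dderD hE _ _ mC1 Uh) -(C1_dderZ hE _ _ mC1 Uh).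
congr (dder _ _ _); rewrite /w curve_dquotE /= nut -/x0.
rewrite /q /r chart_mul_1l chart_mul_1r subrr subr0.
by congr (_, _); rewrite /= subr0 scaler0.
Qed.

(** The bracket with [X] is a limit of the linear maps [(Ad (nu h) - 1) / h], for
    the curve [nu] that is a straight line in the chart. *)
Lemma bracket_linear X : linear_map (bracket X).
Proof.
pose nu (s : R) := cinv c (x0 + s *: X).
have cx : cimg c x0 by exact: cfun_img.
have line : x0 + s *: X @[s --> (0:R)] --> x0.
  rewrite -[X in _ --> X]addr0 -(scale0r X).
  apply: tvs_cvgD; first exact: cvg_cst.
  by apply: tvs_cvgZ; [exact: cvg_id|exact: cvg_cst].
have nu0 : nu 0 = 1%g by rewrite /nu scale0r addr0 /x0 (cfunK c1).
have nuc : nu @ (0:R) --> (1%g : G).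
  rewrite -nu0 {2}/nu scale0r addr0; apply: (cvg_comp _ _ line); exact: cinv_cvg.
have nud : curve_der (c \o nu) 0 X.
  have cst : (fun _ : R => (X : E)) @ (0:R)^' --> (X : E) by exact: cvg_cst.
  apply: cvg_trans cst; apply: near_eq_cvg.
  have H : \forall s \near (0:R), cimg c (x0 + s *: X) by exact: (line _ (cimg_near cx)).
  have H' : \forall s \near (0:R)^', s != 0 /\ cimg c (x0 + s *: X).
    near=> s; split; near: s; first exact: nbhs_dnbhs_neq.
    exact: nbhs_dnbhs.
  apply: filterS H' => s [s0 cs]; rewrite curve_dquotE add0r /= nu0 /nu (cinvK cs).
  by rewrite addrAC subrr add0r scalerA mulVf// scale1r.
have D Z := @Ad_curve_der_at1 nu 0 X Z nu0 nuc nud.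
move=> a Y Z.
apply: (cvg_unique hE (D (a *: Y + Z))).
have : (fun h => a *: dquot ((fun s => Ad (nu s) Y : E) : R^o -> E) 0 1 h +
   dquot ((fun s => Ad (nu s) Z : E) : R^o -> E) 0 1 h) @ (0:R)^' -->
    a *: (bracket X Y : E) + (bracket X Z : E).
  by apply: tvs_cvgD; [apply: tvs_cvgZ; [exact: cvg_cst|exact: D]|exact: D].
apply: cvg_trans; apply: near_eq_cvg; apply: nearW => h.
rewrite !curve_dquotE !Ad_linear scalerA [a * _]mulrC -scalerA -scalerDr.
by congr (_ *: _); rewrite scalerBr opprD addrACA.
Unshelve. all: by end_near. Qed.

End Adjoint.

(** * Growth of the adjoint action along product integrals *)

Section Gronwall.
Context {R : realType} {E : tvsType R}.
Implicit Types (eta : R -> E).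

(** The function [s |-> exp (- K s) * N (eta s)] does not increase: the first order
    growth [1 + K h] of [N \o eta] is absorbed by [exp (K h)]. *)
Lemma gronwall eta a b (N : E -> R) (K : R) : cseminorm N -> 0 <= K -> a <= b ->
  (forall s, s \in `[a, b] -> exists2 d, curve_der eta s d & s \in `]a, b[ -> N d <= K * N (eta s)) ->
  N (eta b) <= expR (K * (b - a)) * N (eta a).
Proof.
move=> Ns K0 ab ed.
pose f s := expR (- (K * s)) * N (eta s).
suff : f b <= f a.
  rewrite /f => /(ler_wpM2l (expR_ge0 (K * b))).
  by rewrite !mulrA -!expRD subrr expR0 mul1r -mulrBr.
apply: dini_nonincreasing ab _ _.
  apply: continuous_in_subspaceT => s /set_mem/= sab.
  have [d ed' _] := ed s sab.
  apply: cvgM; last by apply: (cseminorm_cvg Ns); exact: curve_der_continuous ed'.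
  apply: (@cvg_comp _ _ _ (fun s => - (K * s)) expR); last exact: continuous_expR.
  by apply: cvgN; apply: cvgM; [exact: cvg_cst|exact: cvg_id].
move=> s sab e e0; have [d ed' /(_ sab) Nd] := ed s (subset_itv_oo_cc sab).
have e'0 : 0 < e * expR (K * s) by rewrite mulr_gt0// expR_gt0.
have H := cseminorm_cvg_near Ns (cvg_dnbhs_at_right ed') e'0.
near=> h.
have h0 : 0 < h by near: h; exact: nbhs_right_gt.
have qh : N (dquot (eta : R^o -> E) s 1 h - d) < e * expR (K * s) by near: h; exact: H.
set q := dquot _ _ _ _ in qh.
have Nq : N q <= K * N (eta s) + e * expR (K * s).
  by have := cseminormD Ns (q - d) d; rewrite subrK; lra.
rewrite /f curve_dquotK -/q.
have Nh : N (eta s + h *: q) <= expR (K * h) * N (eta s) + h * (e * expR (K * s)).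
  have h1 := cseminormD Ns (eta s) (h *: q).
  rewrite (cseminormZ Ns) gtr0_norm// in h1.
  have h2 : h * N q <= h * (K * N (eta s) + e * expR (K * s)) by rewrite ler_pM2l.
  have h3 : (1 + K * h) * N (eta s) <= expR (K * h) * N (eta s).
    by apply: ler_wpM2r; [exact: cseminorm_ge0|exact: expR_ge1Dx].
  nra.
have E0 := expR_gt0 (- (K * (s + h))).
apply: (@le_trans _ _ (expR (- (K * (s + h))) * (expR (K * h) * N (eta s) + h * (e * expR (K * s))))).
  by rewrite ler_pM2l.
have -> : - (K * (s + h)) = - (K * s) + - (K * h) by ring.
rewrite expRD mulrDr; apply: lerD.
  rewrite mulrA -[_ * _ * expR _]mulrA -expRD addNr expR0 mulr1.
  exact: lexx.
have -> : expR (- (K * s)) * expR (- (K * h)) * (h * (e * expR (K * s))) =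
   h * e * (expR (- (K * h)) * (expR (- (K * s)) * expR (K * s))) by ring.
rewrite -expRD addNr expR0 mulr1 ler_piMr//.
  by rewrite mulr_ge0// ltW.
by rewrite expR_le1 oppr_le0 mulr_ge0// ltW.
Unshelve. all: by end_near. Qed.

Lemma curve_der_opp eta s d : curve_der eta s d -> curve_der (fun u => eta (- u)) (- s) (- d).
Proof.
move=> ed; rewrite /curve_der.
have h1 : dquot (eta : R^o -> E) s 1 (h * -1) @[h --> (0:R)^'] --> d.
  have n1 : (-1 : R) != 0 by rewrite oppr_eq0 oner_eq0.
  exact: (cvg_comp _ _ (dnbhs0M n1) ed).
suff -> : dquot ((fun u => eta (- u)) : R^o -> E) (- s) 1 =
    (fun h => - dquot (eta : R^o -> E) s 1 (h * -1)) by exact: tvs_cvgN.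
apply/funext => h; rewrite !curve_dquotE -scaleNr mulrN1 invrN.
by rewrite opprD !opprK.
Qed.

Lemma gronwall_backward eta a b (N : E -> R) (K : R) : cseminorm N -> 0 <= K -> a <= b ->
  (forall s, s \in `[a, b] -> exists2 d, curve_der eta s d & s \in `]a, b[ -> N d <= K * N (eta s)) ->
  N (eta a) <= expR (K * (b - a)) * N (eta b).
Proof.
move=> Ns K0 ab ed.
have ab' : - b <= - a by rewrite lerN2.
have := @gronwall (fun u => eta (- u)) (- b) (- a) N K Ns K0 ab'.
rewrite !opprK [- a + b]addrC; apply => s sab.
have [|d ed' Nd] := ed (- s).
  by move: sab; rewrite !in_itv/= => /andP[? ?]; apply/andP; split; lra.
exists (- d); first by rewrite -[s]opprK; exact: curve_der_opp.
move=> sab'; rewrite (cseminormN Ns); apply: Nd.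
by move: sab'; rewrite !in_itv/= => /andP[? ?]; apply/andP; split; lra.
Qed.

Lemma curve_der_near (g1 g2 : R -> E) t d : (\forall s \near t, g1 s = g2 s) ->
  curve_der g1 t d -> curve_der g2 t d.
Proof.
move=> g12; apply: cvg_trans; apply: near_eq_cvg.
have : t + h @[h --> (0:R)^'] --> t + 0.
  by apply: cvgD; [exact: cvg_cst|exact: nbhs_dnbhs].
rewrite addr0 => th.
have : \forall h \near (0:R)^', g1 (t + h) = g2 (t + h) by exact: (th _ g12).
by apply: filterS => h gh; rewrite !curve_dquotE gh (nbhs_singleton g12).
Qed.

(** Continuity follows from [`|N x - N y| <= N (x - y) <= p (x - y)]. *)
Lemma cseminorm_dominated (N p : E -> R) : cseminorm p ->
  (forall x y, N (x + y) <= N x + N y) -> (forall a x, N (a *: x) = `|a| * N x) ->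
  (forall x, N x <= p x) -> cseminorm N.
Proof.
move=> ps ND NZ Np; split => // x; apply/cvgrPdist_lt => e e0.
have NN y : N (- y) = N y by rewrite -scaleN1r NZ normrN1 mul1r.
have h : \forall y \near (x : E), p (y - x) < e.
  by apply: (cseminorm_cvg_near ps) => //; exact: cvg_id.
apply: filterS h => y pe; have {}pe : N (y - x) < e by exact: le_lt_trans pe.
have h1 := ND (y - x) x; rewrite subrK in h1.
have h2 := ND (x - y) y; rewrite subrK -opprB NN in h2.
by rewrite ltr_norml; apply/andP; split; lra.
Qed.

Lemma cseminorm_scale (p : E -> R) k : 0 <= k -> cseminorm p -> cseminorm (fun x => k * p x).
Proof.
move=> k0 ps; split => [x y|a x|x].
- by rewrite -mulrDr; apply: ler_wpM2l => //; exact: cseminormD.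
- by rewrite (cseminormZ ps) mulrCA.
- by apply: cvgM; [exact: cvg_cst|case: ps => _ _ pc; exact: pc].
Qed.

End Gronwall.

Section AdjointGrowth.
Context {R : realType} {E : tvsType R} {G : milnorLieGroupType E}.
Hypothesis hE : hausdorff_space E.

(** By the chain rule for the right translation by [(mu t)^-1], which carries the
    velocity at [t] to the tangent space at [1]. *)
Lemma rlogder_curve_der (a b : R) (mu : R -> G) t :
  CnMap (atlas : set (chart E G)) 1 ([set` `]a, b[] : set R^o) mu -> t \in `]a, b[ ->
  mu @ t --> mu t /\
  curve_der (chart_at (1%g : G) \o (fun s => mu s * (mu t)^-1)%g) t (rlogder mu t).
Proof.
move=> [muc muC] tab.
have oab : open ([set` `]a, b[] : set R^o) by exact: itv_open.
have mut : mu @ t --> mu t.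
  by move: muc; rewrite continuous_open_subspace// => /(_ t (mem_set tab)).
split => //.
set c := chart_at (mu t); set c1 := chart_at (1%g : G).
have cm : cdom c (mu t) by exact: chart_at_dom.
have ovm : open ([set` `]a, b[] `&` mu @^-1` cdom c : set R^o).
  by apply: open_within_preimage => //; exact: cdom_open.
have [_ velC _] := Cn_C1 ovm (muC c (chart_at_atlas _)).
have vel : curve_der (c \o mu) t (velocity mu t).
  by apply: ddiffP; apply: velC; split.
have c1m : cdom c1 (mu t * (mu t)^-1)%g by rewrite mulgV; exact: chart_at_dom.
have h := mulr_tangent hE (chart_at_atlas (mu t)) (chart_at_atlas (mu t)^-1%g)
  (chart_at_atlas (1%g : G)) cm (chart_at_dom _) c1m.
have -> : rlogder mu t = dder (c1 \o (fun k => k * (mu t)^-1)%g \o cinv c) (c (mu t)) (velocity mu t).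
  by rewrite /rlogder /tmap mulgV.
rewrite (has_tangentE hE _ h); case: h => _ _ _ h _.
have := curve_der_comp vel h; apply: curve_der_near.
have : \forall s \near t, cdom c (mu s) by exact: (mut _ (cdom_near cm)).
by apply: filterS => s cs /=; rewrite (cfunK cs).
Qed.

(** Multiplicativity of [Ad] moves the base point [t] to the unit:
    [mu s * g = (mu s * (mu t)^-1) * (mu t * g)]. *)
Lemma Ad_curve_der (a b : R) (mu : R -> G) t g Y :
  CnMap (atlas : set (chart E G)) 1 ([set` `]a, b[] : set R^o) mu -> t \in `]a, b[ ->
  curve_der (fun s => Ad (mu s * g)%g Y : E) t (bracket (rlogder mu t) (Ad (mu t * g)%g Y)).
Proof.
move=> muC tab; have [mut mud] := rlogder_curve_der muC tab.
pose nu s := (mu s * (mu t)^-1)%g.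
have nut : nu t = 1%g by rewrite /nu mulgV.
have nuc : nu @ t --> (1%g : G).
  by rewrite -(mulgV (mu t)); apply: mulg_cvg => //; exact: cvg_cst.
have -> : (fun s => Ad (mu s * g)%g Y : E) = (fun s => Ad (nu s) (Ad (mu t * g)%g Y)).
  by apply/funext => s; rewrite -(AdM hE) /nu mulgA mulgVK.
exact: Ad_curve_der_at1.
Qed.

(** The inverse of the product integral is [mu r * (mu t)^-1], the value at [r] of
    the curve [mu s * (mu t)^-1], which is [1] at [t]. Differentiating in the
    lower end [s] rather than in [t] keeps the bracket on the left of [Ad], where
    the bound on [N] applies. The bound is asked for inside the interval, where
    a curve in [DP0] agrees with its pieces. *)
Lemma Ad_prodint_le (N : E -> R) (K r r' t : R) (phi : R -> liealg G) :
  cseminorm N -> 0 <= K ->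
  Dset r r' phi -> r <= t <= r' ->
  (forall s (Z : liealg G), s \in `]r, r'[ -> N (bracket (phi s) Z) <= K * N Z) ->
  forall Y : liealg G, N (Ad (prodint r r' phi t)^-1%g Y) <= expR (K * (t - r)) * N Y.
Proof.
move=> Ns K0 Dphi /andP[rt tr'] NK Y.
rewrite /prodint; set mu := xget _ _.
have : rprimitive r r' phi mu by exact: (xgetPex (fun=> 1%g) Dphi).
move=> [[a [b [ar rb muC]]] phiE].
have tt : N Y = N (Ad (mu t * (mu t)^-1)%g Y) by rewrite mulgV (Ad1 hE).
rewrite invgM invgK tt.
apply: (@gronwall_backward _ _ (fun s => Ad (mu s * (mu t)^-1)%g Y)) => // s.
rewrite in_itv/= => /andP[rs st].
have sab : s \in `]a, b[ by rewrite in_itv/=; apply/andP; split; lra.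
exists (bracket (rlogder mu s) (Ad (mu s * (mu t)^-1)%g Y)).
  exact: Ad_curve_der muC sab.
rewrite in_itv/= => /andP[rs' st'].
rewrite -phiE; last by rewrite in_itv/=; apply/andP; split; lra.
by apply: NK; rewrite in_itv/=; apply/andP; split; lra.
Qed.

(** The bounds on the pieces multiply to [exp (K t)]. The argument applies to every
    decomposition of [phi], hence to the one selected by [DP0_prodint]. *)
Lemma Ad_DP0_prodint_le (N : E -> R) (K : R) (phi : R -> liealg G) :
  cseminorm N -> 0 <= K ->
  (forall s (Z : liealg G), N (bracket (phi s) Z) <= K * N Z) ->
  forall t (Y : liealg G), t \in `[0, 1] ->
    N (Ad (DP0_prodint phi t)^-1%g Y) <= expR K * N Y.
Proof.
move=> Ns K0 NK t Y; rewrite in_itv/= => /andP[t0 t1].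
have e1 : 1 <= expR K by rewrite -expR0 ler_expR.
have triv : N (Ad 1^-1%g Y) <= expR K * N Y.
  by rewrite invg1 (Ad1 hE) ler_peMl// (cseminorm_ge0 Ns).
rewrite /DP0_prodint; case: xgetP => [g _ | _ //].
move=> [[_ ->]//|[n [s [psi [p [[s0 sn smono sD] pn /andP[spt tsp] ->]]]]]].
have psiK q u Z : (q < n)%N -> u \in `]s q, s q.+1[ -> N (bracket (psi q u) Z) <= K * N Z.
  by move=> qn uq; rewrite -(sD q qn).2.
have upto q Z : (q <= n)%N -> N (Ad (prodint_upto s psi q)^-1%g Z) <= expR (K * s q) * N Z.
  elim: q Z => [|q IH] Z qn.
    by rewrite /= invg1 (Ad1 hE) s0 mulr0 expR0 mul1r.
  rewrite /= invgM (AdM hE); apply: le_trans (IH _ (ltnW qn)) _.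
  have -> : K * s q.+1 = K * s q + K * (s q.+1 - s q) by ring.
  rewrite expRD -mulrA ler_pM2l ?expR_gt0//.
  apply: Ad_prodint_le => //; first exact: (sD q qn).1.
    by rewrite lexx ltW// smono.
  by move=> u V; exact: psiK.
rewrite invgM (AdM hE); apply: le_trans (upto _ _ (ltnW pn)) _.
apply: (@le_trans _ _ (expR (K * s p) * (expR (K * (t - s p)) * N Y))).
  rewrite ler_pM2l ?expR_gt0//; apply: Ad_prodint_le => //; first exact: (sD p pn).1.
    by rewrite ltW.
  by move=> u V; exact: psiK.
rewrite mulrA -expRD; apply: ler_wpM2r; first exact: cseminorm_ge0.
by rewrite ler_expR -mulrDr addrC subrK ler_piMr.
Qed.

End AdjointGrowth.

(** * Tameness in constricted groups *)

Section Tameness.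
Context {R : realType} {E : tvsType R} {G : milnorLieGroupType E}.
Variable Xi : chart E G.
Hypothesis hE : hausdorff_space E.
Hypothesis Xi_smooth : smooth_chart Xi.
Hypothesis Xi_dom : cdom Xi 1%g.

(** The derivative at [1] of the change of charts is linear and continuous. *)
Lemma dotp_cseminorm (p : E -> R) : cseminorm p -> cseminorm (dotp Xi p : E -> R).
Proof.
move=> ps; set c := chart_at (1%g : G).
have C := transition_C1 (Xi_smooth (chart_at_atlas (1%g : G))).1.
have U1 : (cimg c `&` cinv c @^-1` cdom Xi) (c 1%g).
  split; first exact: cfun_img (chart_at_dom _).
  by rewrite /= (cfunK (chart_at_dom _)).
split => [x y|a x|x].
- rewrite /dotp /dchart (C1_dderD hE _ _ C U1); exact: cseminormD.
- by rewrite /dotp /dchart (C1_dderZ hE _ _ C U1) (cseminormZ ps).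
- apply: (cseminorm_cvg ps); case: C => _ _ /(_ _ x U1) dc.
  have h : (fun y : E => (c 1%g, y)) @ x --> (c 1%g, x).
    by apply: cvg_pair; [exact: cvg_cst|exact: cvg_id].
  exact: (cvg_comp _ _ h dc).
Qed.

Lemma ad_iter_linear (s : seq (liealg G)) : linear_map (ad_iter s).
Proof.
elim: s => [//|X s IH] a v w; rewrite /ad_iter /= -!/(ad_iter s _) IH.
exact: bracket_linear.
Qed.

Variables (B : set (liealg G)) (v w : E -> R) (K : R).
Hypotheses (vs : cseminorm v) (ws : cseminorm w) (vw : forall x, v x <= w x).
Hypothesis K0 : 0 < K.
Hypothesis adK : forall s : seq (liealg G), (0 < size s)%N ->
  (forall X, X \in s -> B X) -> forall Y, dotp Xi v (ad_iter s Y) <= K ^+ size s * dotp Xi w Y.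

Definition ad_values (Z : E) : set R := [set y | exists s : seq (liealg G),
  (forall X, X \in s -> B X) /\ y = K ^- size s * dotp Xi v (ad_iter s Z)].

(** The supremum over all words in [B], the empty one included, of the iterated
    brackets renormalized by [K] per letter; see [ad_seminorm_bracket]. *)
Definition ad_seminorm (Z : E) : R := sup (ad_values Z).

Let vd := dotp_cseminorm vs.
Let wd := dotp_cseminorm ws.

Lemma ad_values_le Z y : ad_values Z y -> y <= dotp Xi w Z.
Proof.
move=> [s [sB ->]]; case: s sB => [_|X s sB].
  by rewrite /= expr0 invr1 mul1r; exact: vw.
by rewrite ler_pdivrMl ?exprn_gt0//; apply: adK.
Qed.

Lemma ad_values_has_sup Z : has_sup (ad_values Z).
Proof.
split; last by exists (dotp Xi w Z) => y; exact: ad_values_le.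
by exists (dotp Xi v Z), [::]; split => //=; rewrite expr0 invr1 mul1r.
Qed.

Lemma ad_seminorm_ge Z s : (forall X, X \in s -> B X) ->
  K ^- size s * dotp Xi v (ad_iter s Z) <= ad_seminorm Z.
Proof. by move=> sB; apply: (sup_upper_bound (ad_values_has_sup Z)); exists s. Qed.

Lemma ad_seminorm_le Z y : (forall s, (forall X, X \in s -> B X) ->
  K ^- size s * dotp Xi v (ad_iter s Z) <= y) -> ad_seminorm Z <= y.
Proof.
move=> h; apply: ge_sup; first exact: (ad_values_has_sup Z).1.
by move=> _ [s [sB ->]]; exact: h.
Qed.

Lemma dotp_le_ad_seminorm Z : dotp Xi v Z <= ad_seminorm Z.
Proof. by have := @ad_seminorm_ge Z [::]; rewrite /= expr0 invr1 mul1r; apply. Qed.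

Lemma ad_seminorm_le_dotp Z : ad_seminorm Z <= dotp Xi w Z.
Proof. by apply: ge_sup; [exact: (ad_values_has_sup Z).1|exact: ad_values_le]. Qed.

Lemma ad_seminormZ_le a Z : ad_seminorm (a *: Z) <= `|a| * ad_seminorm Z.
Proof.
apply: ad_seminorm_le => s sB.
have -> : ad_iter s (a *: Z) = a *: ad_iter s Z.
  have := ad_iter_linear s a Z 0; rewrite addr0 => ->.
  have := ad_iter_linear s (-1) 0 0; rewrite scaler0 addr0 scaleN1r addNr => ->.
  by rewrite addr0.
rewrite (cseminormZ vd) mulrCA; apply: ler_wpM2l => //.
exact: ad_seminorm_ge.
Qed.

Lemma ad_seminorm_cseminorm : cseminorm ad_seminorm.
Proof.
have N0 Z : 0 <= ad_seminorm Z.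
  by apply: le_trans (dotp_le_ad_seminorm Z); exact: (cseminorm_ge0 vd).
apply: (cseminorm_dominated wd) => [Y Z|a Z|]; last exact: ad_seminorm_le_dotp.
  apply: ad_seminorm_le => s sB.
  have -> : ad_iter s (Y + Z) = ad_iter s Y + ad_iter s Z.
    by have := ad_iter_linear s 1 Y Z; rewrite !scale1r.
  have h : K ^- size s * dotp Xi v (ad_iter s Y + ad_iter s Z) <=
    K ^- size s * (dotp Xi v (ad_iter s Y) + dotp Xi v (ad_iter s Z)).
    apply: ler_wpM2l; first by rewrite invr_ge0 exprn_ge0// ltW.
    exact: (cseminormD vd).
  apply: le_trans h _; rewrite mulrDr; apply: lerD; exact: ad_seminorm_ge.
apply/eqP; rewrite eq_le ad_seminormZ_le/=.
have [->|a0] := eqVneq a 0; first by rewrite normr0 mul0r.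
have := ad_seminormZ_le a^-1 (a *: Z).
by rewrite scalerA mulVf// scale1r normfV -ler_pdivrMl ?invr_gt0 ?normr_gt0// invrK.
Qed.

(** A word applied to [bracket X Z] is a word with one more letter applied to [Z],
    which costs exactly one factor [K]. *)
Lemma ad_seminorm_bracket X Z : B X -> ad_seminorm (bracket X Z) <= K * ad_seminorm Z.
Proof.
move=> BX; apply: ad_seminorm_le => s sB.
have := @ad_seminorm_ge Z (rcons s X).
rewrite /ad_iter foldr_rcons -/(ad_iter s _) size_rcons => h.
rewrite -ler_pdivrMl// mulrA -invfM -exprS; apply: h => Y.
by rewrite mem_rcons inE => /predU1P[->|/sB].
Qed.

End Tameness.

Section ConstrictedTame.
Context {R : realType} {E : tvsType R} {G : milnorLieGroupType E}.
Variable Xi : chart E G.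
Hypothesis hE : hausdorff_space E.
Hypothesis Xi_smooth : smooth_chart Xi.
Hypothesis Xi_dom : cdom Xi 1%g.
Hypothesis G_constricted : constricted Xi.

Lemma bounded_tame (B : set (liealg G)) (phi_ : nat -> R -> liealg G) :
  bounded_in_liealg Xi B -> (forall n t, B (phi_ n t)) -> tame Xi phi_.
Proof.
move=> Bb phiB v vs.
have [C [w [C0 ws vw adC]]] := G_constricted Bb vs.
(* [C] may be zero, while the seminorm divides by powers of [K] *)
pose K := C + 1.
have K0 : 0 < K by rewrite /K ltr_wpDl.
have adK (s : seq (liealg G)) : (0 < size s)%N -> (forall X, X \in s -> B X) ->
    forall Y, dotp Xi v (ad_iter s Y) <= K ^+ size s * dotp Xi w Y.
  move=> s0 sB Y; apply: le_trans (adC s s0 sB Y) _.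
  apply: ler_wpM2r; first exact: (cseminorm_ge0 (dotp_cseminorm hE Xi_smooth Xi_dom ws)).
  by apply: lerXn2r; rewrite ?nnegrE /K//; lra.
exists (fun x => expR K * w x); split.
- by apply: cseminorm_scale => //; exact: expR_ge0.
- move=> x; apply: le_trans (vw x) _; rewrite ler_peMl ?(cseminorm_ge0 ws)//.
  by rewrite -expR0 ler_expR ltW.
- move=> n t X t01.
  have Ns := ad_seminorm_cseminorm hE Xi_smooth Xi_dom vs ws vw K0 adK.
  apply: le_trans (dotp_le_ad_seminorm vw K0 adK _) _.
  have bK s Z := ad_seminorm_bracket vw K0 adK Z (phiB n s).
  apply: le_trans (Ad_DP0_prodint_le hE Ns (ltW K0) bK X t01) _.
  rewrite ler_pM2l ?expR_gt0//; exact: ad_seminorm_le_dotp.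
Qed.

End ConstrictedTame.

(** * Approximation by step functions *)

Section Grid.
Context {R : realType}.

(** The [minn] keeps the value in [[0, 1]] for every real [t], so that a step
    function takes only values of the given curve on [[0, 1]]. *)
Definition grid (n : nat) (t : R) : R :=
  (minn (Num.truncn (t * n.+1%:R)) n.+1)%:R / n.+1%:R.

Lemma grid_itv n t : grid n t \in `[0, 1].
Proof.
rewrite in_itv/= divr_ge0//= ler_pdivrMr ?ltr0Sn// mul1r ler_nat.
exact: geq_minr.
Qed.

Lemma grid_const n k t : (k < n.+1)%N -> t \in `]k%:R / n.+1%:R, k.+1%:R / n.+1%:R[ ->
  grid n t = k%:R / n.+1%:R.
Proof.
move=> kn; rewrite in_itv/= ltr_pdivrMr ?ltr0Sn// ltr_pdivlMr ?ltr0Sn// => /andP[kt tk].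
rewrite /grid (@truncn_def _ _ k) ?(ltW kt)//.
by rewrite (minn_idPl _)// ltnW.
Qed.

Lemma grid_dist n t : t \in `[0, 1] -> `|t - grid n t| <= n.+1%:R^-1.
Proof.
rewrite in_itv/= => /andP[t0 t1]; have n0 : (0 : R) < n.+1%:R by rewrite ltr0Sn.
have tn0 : 0 <= t * n.+1%:R by rewrite mulr_ge0// ltW.
have /andP[kt tk] := truncn_itv tn0.
have km : (Num.truncn (t * n.+1%:R) <= n.+1)%N.
  by rewrite -(ler_nat R); apply: le_trans kt _; rewrite ler_piMl// ltW.
rewrite /grid (minn_idPl km).
set k := Num.truncn _ in kt tk *.
have -> : t - k%:R / n.+1%:R = (t * n.+1%:R - k%:R) / n.+1%:R.
  by rewrite mulrBl mulfK// gt_eqF.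
rewrite normrM normfV (gtr0_norm n0) ler_piMl ?invr_ge0 ?(ltW n0)//.
rewrite -natr1 in tk.
by rewrite ger0_norm ?subr_ge0//; lra.
Qed.

End Grid.

Section UniformContinuity.
Context {R : realType} {E : tvsType R}.

(** The point [y] is not required to lie in [A]: [psi] is continuous on a
    neighborhood of each point of [A]. *)
Lemma compact_uniform_continuity (A : set R) (psi : R -> E) (p : E -> R) (e : R) :
  compact A -> cseminorm p -> (forall x, A x -> psi @ x --> psi x) -> 0 < e ->
  exists2 d, 0 < d & forall x y, A x -> `|x - y| < d -> p (psi x - psi y) < e.
Proof.
move=> /compact_near_coveringP cA ps psic e0.
have e20 : 0 < e / 2 by rewrite divr_gt0.
pose P (d x : R) := forall y, `|x - y| < d -> p (psi x - psi y) < e.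
have H : \forall d \near (0:R)^'+, A `<=` P d.
  apply: cA => x Ax.
  have near_x : nbhs x [set y | p (psi y - psi x) < e / 2].
    exact: (cseminorm_cvg_near ps (psic x Ax) e20).
  have [d /= d0 dP] := (nbhs_ballP _ _).1 near_x.
  have d20 : 0 < d / 2 by rewrite divr_gt0.
  exists (ball x (d / 2), [set r | r < d / 2]) => /=.
    split; first exact: nbhsx_ballx.
    exact: nbhs_right_lt.
  move=> [x' r] /= [xx' rd] y x'y; rewrite /ball/= in xx'.
  have h1 : p (psi x' - psi x) < e / 2 by apply: dP; rewrite /ball/=; lra.
  have h2 : p (psi y - psi x) < e / 2.
    apply: dP; rewrite /ball/=; have := ler_distD x' x y; lra.
  have := cseminormB ps (psi x' - psi x) (psi y - psi x).
  by rewrite opprB addrA subrK; lra.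
near (0:R)^'+ => d; exists d; first by near: d; exact: nbhs_right_gt.
have AP : A `<=` P d by near: d.
by move=> x y Ax; exact: AP.
Unshelve. all: by end_near. Qed.

Lemma compact_seminorm_bounded (a b : R) (psi : R -> E) (p : E -> R) :
  a <= b -> cseminorm p -> {in `[a, b], forall x, psi @ x --> psi x} ->
  exists2 M, 0 <= M & {in `[a, b], forall x, p (psi x) <= M}.
Proof.
move=> ab ps psic.
have [x xab xM] : exists2 x, x \in `[a, b] & forall t, t \in `[a, b] -> p (psi t) <= p (psi x).
  apply: (EVT_max ab); apply: continuous_in_subspaceT => x /set_mem/= xab.
  by apply: (cseminorm_cvg ps); exact: psic.
by exists (p (psi x)); first exact: cseminorm_ge0.
Qed.

Lemma C1_lipschitz (a b : R) (U : set R^o) (psi : R -> E) (p : E -> R) :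
  a <= b -> cseminorm p -> C1 U (psi : R^o -> E) -> [set` `[a, b]] `<=` U ->
  exists2 L, 0 <= L & {in `[a, b] &, forall t t', p (psi t - psi t') <= L * `|t - t'|}.
Proof.
move=> ab ps [_ psid psic] abU.
have [|L L0 LP] := @compact_seminorm_bounded a b (fun t => dder (psi : R^o -> E) t 1) p ab ps.
  move=> t tab; have := psic t 1 (abU _ tab).
  have h : (fun s : R => (s : R^o, 1 : R^o)) @ t --> (t : R^o, 1 : R^o).
    apply: (@cvg_pair _ _ _ (nbhs t) (nbhs (t : R^o)) (nbhs (1 : R^o))).
      exact: cvg_id.
    exact: cvg_cst.
  by move=> /(cvg_comp _ _ h).
exists L => //.
have main t t' : t \in `[a, b] -> t' \in `[a, b] -> t <= t' -> p (psi t' - psi t) <= L * `|t' - t|.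
  move=> tab t'ab tt'; rewrite (@ger0_norm _ (t' - t)) ?subr_ge0//.
  have := @mean_value_le _ _ psi t t' p 0 L ps tt'; rewrite scaler0 subr0; apply => s stt'.
  have sab : s \in `[a, b].
    move: tab t'ab stt'; rewrite !in_itv/= => /andP[? ?] /andP[? ?] /andP[? ?].
    by apply/andP; split; lra.
  exists (dder (psi : R^o -> E) s 1); last by rewrite subr0; exact: LP.
  by apply: ddiffP; apply: psid; exact: abU.
move=> t t' tab t'ab; have [tt'|t't] := leP t t'; last by apply: main => //; exact: ltW.
by rewrite -(cseminormN ps) opprB distrC; exact: main.
Qed.

End UniformContinuity.

Section Integrability.
Context {R : realType} {E : tvsType R} {G : milnorLieGroupType E}.
Variable Xi : chart E G.
Hypothesis hE : hausdorff_space E.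
Hypothesis Xi_smooth : smooth_chart Xi.
Hypothesis Xi_dom : cdom Xi 1%g.
Hypothesis G_constricted : constricted Xi.
Hypothesis G_exp : has_exp G.
Implicit Types (phi : R -> liealg G) (p : E -> R).

Let dotps p (ps : cseminorm p) := dotp_cseminorm hE Xi_smooth Xi_dom ps.

Definition step phi (n : nat) (t : R) : liealg G := phi (grid n t).

(** The exponential map provides a primitive on [[0, 1]] of each constant, which is
    also one on the smaller interval. *)
Lemma step_DP0 phi n : DP0 (step phi n).
Proof.
pose s k : R := k%:R / n.+1%:R.
exists n.+1, s, (fun k => cst (phi (s k))); split.
- by rewrite /s mul0r.
- by rewrite /s divff.
- by move=> k _; rewrite /s ltr_pM2r ?invr_gt0 ?ltr0Sn// ltr_nat.
move=> k kn; split; last first.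
  by move=> t tk; rewrite /step (grid_const kn).
have [mu [[a [b [a0 b1 muC]]] muE]] := G_exp (phi (s k)).
have sk0 : 0 <= s k by rewrite divr_ge0.
have sk1 : s k.+1 <= 1 by rewrite ler_pdivrMr ?ltr0Sn// mul1r ler_nat.
exists mu; split.
  by exists a, b; split => //; lra.
move=> t; rewrite in_itv/= => /andP[skt tsk].
by apply: muE; rewrite in_itv/=; apply/andP; split; lra.
Qed.

Lemma step_tame phi : bounded_in_liealg Xi (phi @` [set` `[0, 1]]) -> tame Xi (step phi).
Proof.
move=> pb; apply: (bounded_tame hE Xi_smooth Xi_dom G_constricted pb) => n t.
by exists (grid n t) => //; exact: grid_itv.
Qed.

Lemma psup_le p phi psi (e : R) :
  (forall t, t \in `[0, 1] -> dotp Xi p (phi t - psi t) <= e) ->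
  (psup Xi p (phi \- psi)%R <= e%:E)%E.
Proof. by move=> h; apply: ge_ereal_sup => _ [t t01 <-]; rewrite lee_fin; exact: h. Qed.

Lemma le_psup p phi psi (e : R) t : t \in `[0, 1] ->
  (psup Xi p (phi \- psi)%R <= e%:E)%E -> dotp Xi p (phi t - psi t) <= e.
Proof.
move=> t01 h; rewrite -lee_fin; apply: le_trans h.
by apply: ereal_sup_ubound; exists t.
Qed.

Lemma unif_converges_Cauchy (phi_ : nat -> R -> liealg G) phi :
  unif_converges Xi phi_ phi -> unif_Cauchy Xi phi_.
Proof.
move=> conv p e ps e0; have e20 : 0 < e / 2 by rewrite divr_gt0.
have [l lP] := conv p _ ps e20; exists l => m n lm ln.
apply: psup_le => t t01.
have hm := le_psup t01 (lP m lm); have hn := le_psup t01 (lP n ln).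
have := cseminormB (dotps ps) (phi t - phi_ n t) (phi t - phi_ m t).
by rewrite opprB addrC subrKA; lra.
Qed.

Lemma continuous_s_integrable phi : restricted_curve (Cn 0) phi -> s_integrable Xi phi.
Proof.
move=> [a [b [psi [a0 b1 psiC phiE]]]].
have psic : {in `[0, 1], forall x, psi x @[x --> x] --> (psi x : E)}.
  move=> x; rewrite in_itv/= => /andP[x0 x1].
  apply: (Cn_continuous (U := [set` `]a, b[]) _ psiC); first exact: itv_open.
  by rewrite /= in_itv/=; apply/andP; split; lra.
have conv : unif_converges Xi (step phi) phi.
  move=> p e ps e0.
  have [d d0 dP] := compact_uniform_continuity (@segment_compact _ 0 1) (dotps ps) psic e0.
  have [l _ lP] := @near_infty_natSinv_lt R (PosNum d0).
  exists l => n ln; apply: psup_le => t t01.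
  rewrite /step (phiE _ t01) (phiE _ (grid_itv n t)).
  apply: ltW; apply: dP => //; apply: le_lt_trans (grid_dist n t01) _.
  exact: lP.
exists (step phi); split => //; first exact: step_DP0.
  apply: step_tame => p ps.
  have [M _ MP] := compact_seminorm_bounded ler01 (dotps ps) psic.
  by exists M => _ [t t01 <-]; rewrite (phiE _ t01); exact: MP.
exact: unif_converges_Cauchy conv.
Qed.

Lemma lip_m_integrable phi : lip_curve Xi phi -> m_integrable Xi phi.
Proof.
move=> lip.
exists (step phi); split; first exact: step_DP0.
- apply: step_tame => p ps; have [L L0 LP] := lip p ps.
  exists (L + dotp Xi p (phi 0)) => _ [t /= t01 <-].
  have i0 : (0:R) \in `[0, 1] by rewrite in_itv/= lexx ler01.
  have := cseminormD (dotps ps) (phi t - phi 0) (phi 0); rewrite subrK.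
  have := LP t 0 t01 i0; rewrite subr0.
  have : L * `|t| <= L.
    by rewrite ler_piMr//; move: t01; rewrite in_itv/= => /andP[t0 t1]; rewrite ger0_norm.
  lra.
- exists (fun m n => m.+1%:R^-1 + n.+1%:R^-1); split.
  + by move=> m n; rewrite addr_ge0.
  + rewrite -[X in _ --> X]addr0; apply: cvgD.
      exact: (cvg_comp _ _ cvg_fst cvg_harmonic).
    exact: (cvg_comp _ _ cvg_snd cvg_harmonic).
  + move=> p ps; have [L L0 LP] := lip p ps; exists L, 0%N; split => // m n _ _.
    apply: psup_le => t t01; apply: le_trans (LP _ _ (grid_itv m t) (grid_itv n t)) _.
    apply: ler_wpM2l => //; apply: le_trans (ler_distD t _ _) _.
    by apply: lerD; [rewrite distrC|]; exact: grid_dist.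
- move=> p e ps e0; have [L L0 LP] := lip p ps.
  have d0 : 0 < e / (L + 1) by rewrite divr_gt0// ltr_wpDl.
  have [l _ lP] := @near_infty_natSinv_lt R (PosNum d0).
  exists l => n ln; apply: psup_le => t t01.
  apply: le_trans (LP _ _ t01 (grid_itv n t)) _.
  have h : `|t - grid n t| <= e / (L + 1) := le_trans (grid_dist n t01) (ltW (lP n ln)).
  apply: (@le_trans _ _ (L * (e / (L + 1)))); first exact: ler_wpM2l.
  rewrite mulrCA ler_piMr ?(ltW e0)// ler_pdivrMr ?ltr_wpDl// mul1r; lra.
Qed.

Lemma C1_lip_curve k phi : restricted_curve (Cn k.+1) phi -> lip_curve Xi phi.
Proof.
move=> [a [b [psi [a0 b1 psiC phiE]]]] p ps.
have oab : open ([set` `]a, b[] : set R^o) by exact: itv_open.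
have sub : [set` `[(0:R), 1]] `<=` ([set` `]a, b[] : set R^o).
  by move=> t /=; rewrite !in_itv/= => /andP[? ?]; apply/andP; split; lra.
have [L L0 LP] := C1_lipschitz ler01 (dotps ps) (Cn_C1 oab psiC) sub.
by exists L => // t t' t01 t'01; rewrite (phiE _ t01) (phiE _ t'01); exact: LP.
Qed.

End Integrability.
Theorem proposition5 (R : realType) (E : tvsType R) (G : milnorLieGroupType E)
  (Xi : chart E G)
  (hausdorffE : hausdorff_space E)
  (Xi_smooth : smooth_chart Xi)
  (Xi_dom : cdom Xi 1%g)
  (Xi1 : Xi 1%g = 0)
  (Xi_convex : convex_set (cimg Xi))
  (G_constricted : constricted Xi)
  (G_exp : has_exp G)
  (g_complete : seq_complete (liealg G)) :
  forall k : regularity, confined Xi k.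
Proof.
have lip phi := @lip_m_integrable _ _ _ _ hausdorffE Xi_smooth Xi_dom G_constricted G_exp phi.
have C1_lip k phi := @C1_lip_curve _ _ _ _ hausdorffE Xi_smooth Xi_dom k phi.
case=> [[|n]||] /= phi.
- exact: continuous_s_integrable.
- by move=> phiC; apply: lip; exact: C1_lip phiC.
- exact: lip.
- move=> [a [b [psi [a0 b1 psiC phiE]]]]; apply: lip; apply: (C1_lip 0%N).
  by exists a, b, psi; split.
Qed.
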